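(* Let $n\ge 1$, let $\Gamma$ be the surface $x_{n+1}=e^{x_1^2}+\cdots+e^{x_n^2}$ in $\mathbb R^{n+1}$, and let $\Lambda$ be an affine hyperplane in $\mathbb R^{n+1}$ (of dimension $n$). Then $(\Gamma,\Lambda)$ is a Heisenberg uniqueness pair if and only if $\Lambda$ is parallel to the hyperplane $x_{n+1}=0$.
   Context: For a smooth hypersurface $\Gamma\subset\mathbb R^{n+1}$, consider the finite complex Borel measures $\mu$ on $\mathbb R^{n+1}$ which are supported on $\Gamma$ and absolutely continuous with respect to the surface measure on $\Gamma$; the Fourier transform is $\hat\mu(x)=\int_\Gamma e^{-\pi i\,x\cdot u}\,d\mu(u)$, $x\in\mathbb R^{n+1}$. For $\Lambda\subset\mathbb R^{n+1}$, the pair $(\Gamma,\Lambda)$ is a Heisenberg uniqueness pair if the only such $\mu$ with $\hat\mu|_\Lambda=0$ is $\mu=0$. ''Parallel to the hyperplane $x_{n+1}=0$'' means being of the form $x_{n+1}=\text{const}$ (including $x_{n+1}=0$ itself). *)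

(* Defs.v *)
From mathcomp Require Import all_boot all_order all_algebra.
From mathcomp Require Import complex.
From mathcomp Require Import all_classical all_reals all_analysis.

Set Implicit Arguments.
Unset Strict Implicit.
Unset Printing Implicit Defensive.

Import Order.TTheory GRing.Theory Num.Theory.
Import numFieldNormedType.Exports.

Local Open Scope classical_set_scope.
Local Open Scope ring_scope.

Section Euclidean.
Context {R : realType} {N : nat}.
Implicit Types (x y : 'rV[R]_N) (A : set 'rV[R]_N).

Definition dotv x y : R := \sum_(i < N) x ord0 i * y ord0 i.

(* The library norm `|x| on 'rV_N is the sup norm. *)
Definition enorm x : R := Num.sqrt (dotv x x).

Local Open Scope ereal_scope.

(* The maximum with 0 only matters for the empty set, whose sup is -oo. *)
Definition ediam A : \bar R :=
  maxe 0 (ereal_sup [set (enorm (p.1 - p.2)%R)%:E | p in A `*` A]).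

Definition hausdorff_pre (k : nat) (delta : R) A : \bar R :=
  ereal_inf [set \sum_(0 <= j <oo) ediam (U j) ^+ k |
             U in [set U : (set 'rV[R]_N)^nat |
                   A `<=` \bigcup_j U j /\ forall j, ediam (U j) <= delta%:E]].

(* k-dimensional Hausdorff (outer) measure for k >= 1, without the constant
   vol(B^k) / 2 ^ k that makes it agree with Lebesgue measure on k-planes. *)
Definition hausdorff (k : nat) A : \bar R :=
  ereal_sup [set hausdorff_pre k delta A | delta in [set delta | (0 < delta)%R]].

End Euclidean.

(* R^N with its Borel sigma-algebra. *)
Notation borel_rV R N := (g_sigma_algebraType (@open 'rV[R]_N)).

(* The surface measure of a hypersurface G of R^n.+1, as the restriction to G
   of the n-dimensional Hausdorff measure. The normalizing constant plays no
   role, as this measure only occurs through its null sets. *)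
Definition surface_measure (R : realType) (n : nat) (G : set 'rV[R]_n.+1)
    (A : set (borel_rV R n.+1)) : \bar R :=
  hausdorff n (A `&` G).

Section ComplexMeasure.
Context d (T : measurableType d) (R : realType).

(* Charges are finite by definition. *)
Record complex_measure := ComplexMeasure {
  re_charge : {charge set T -> \bar R} ;
  im_charge : {charge set T -> \bar R} }.

Definition complex_measure_fun (mu : complex_measure) (A : set T) : R[i] :=
  (fine (re_charge mu A) +i* fine (im_charge mu A))%C.

Coercion complex_measure_fun : complex_measure >-> Funclass.

Definition supported_on (mu : complex_measure) (G : set T) :=
  forall A, measurable A -> A `&` G = set0 -> mu A = 0.

Definition abs_continuous (mu : complex_measure) (sigma : set T -> \bar R) :=
  forall A, measurable A -> sigma A = 0%E -> mu A = 0.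

(* An arbitrary Hahn decomposition of nu; the integral below does not depend
   on this choice. *)
Definition hahn_cid (nu : {charge set T -> \bar R}) :
    {PN : set T * set T | hahn_decomposition nu PN.1 PN.2} :=
  let (P, exN) := cid (Hahn_decomposition nu) in
  let (N, nuPN) := cid exN in exist _ (P, N) nuPN.

Definition charge_integral (nu : {charge set T -> \bar R}) (f : T -> R) : R :=
  let nuPN := proj2_sig (hahn_cid nu) in
  Rintegral (jordan_pos nuPN) setT f - Rintegral (jordan_neg nuPN) setT f.

Definition complex_integral (mu : complex_measure) (f : T -> R[i]) : R[i] :=
  let u x := complex.Re (f x) in
  let v x := complex.Im (f x) in
  ((charge_integral (re_charge mu) u - charge_integral (im_charge mu) v) +i*
   (charge_integral (re_charge mu) v + charge_integral (im_charge mu) u))%C.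

End ComplexMeasure.

Section Heisenberg.
Context {R : realType} {n : nat}.

(* e^{- i t} *)
Definition expNi (t : R) : R[i] := (cos t +i* - sin t)%C.

Definition fourier (mu : complex_measure (borel_rV R n.+1) R)
    (x : 'rV[R]_n.+1) : R[i] :=
  complex_integral mu (fun u : 'rV[R]_n.+1 => expNi (pi * dotv x u)).

(* Meant for G a smooth hypersurface. *)
Definition heisenberg_uniqueness_pair (G L : set 'rV[R]_n.+1) :=
  forall mu : complex_measure (borel_rV R n.+1) R,
    supported_on mu G -> abs_continuous mu (surface_measure G) ->
    (forall x, L x -> fourier mu x = 0) ->
    forall A, measurable A -> mu A = 0.

Definition affine_hyperplane (L : set 'rV[R]_n.+1) :=
  exists (a : 'rV[R]_n.+1) (b : R), a != 0 /\ L = [set x | dotv a x = b].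

(* The last coordinate x_{n+1} of x is x ord0 ord_max. *)
Definition parallel_to_base (L : set 'rV[R]_n.+1) :=
  exists c : R, L = [set x | x ord0 ord_max = c].

Definition exp_square_surface : set 'rV[R]_n.+1 :=
  [set x | x ord0 ord_max =
           \sum_(i < n) expR (x ord0 (widen_ord (leqnSn n) i) ^+ 2)].

End Heisenberg.

(* Main.v *)
(* Write y for the first n coordinates of a point of the surface and u for its
   last one, which is a function of y on the surface.

   If L is {x_{n+1} = c}, the hypothesis says that the projection to the y-space
   of the measure e^{- i pi c u} d(mu) has a vanishing Fourier transform. The
   bounded functions by which every measure with this property may be multiplied
   without losing it are closed under sums, products and bounded pointwise
   limits. They contain the functions cos (xi . y + b), hence
   sg (sin ((y_i - a) / m)), as sg is a pointwise limit of polynomials on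
   [-1, 1], hence sg (y_i - a) for m -> oo, hence the indicators of all Borel
   sets, as mu lives on a graph over the y-space. So mu = 0.

   If L = {a . x = b} with a_k <> 0 for some k <= n, then a line in the direction
   a through a point below the surface meets the surface on both sides of that
   point, by the growth of exp (y_k ^ 2). Draw such a line p + R a at random,
   with n free coordinates uniform in [0, 1], and let t2 < 0 < t1 be the extreme
   parameters of intersection. The law of p + t1 a minus the law of p + t2 a
   weighted by e^{i pi b (t2 - t1)} has a Fourier transform vanishing on L, and
   it is absolutely continuous because the free coordinates are Lipschitz
   functions of the point of intersection. *)

Require Import Defs.
From HB Require Import structures.
From mathcomp Require Import all_boot all_order all_algebra.
From mathcomp Require Import complex.
From mathcomp Require Import all_classical all_reals all_analysis.
From mathcomp Require Import measurable_realfun.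
From mathcomp Require Import ring lra.

Set Implicit Arguments.
Unset Strict Implicit.
Unset Printing Implicit Defensive.

Import Order.TTheory GRing.Theory Num.Theory.
Import numFieldNormedType.Exports.

Local Open Scope classical_set_scope.
Local Open Scope ring_scope.

(** * Bounded functionals and integrals against charges *)

Section BoundedFunctionals.
Context d (T : measurableType d) (R : realType).
Implicit Types (f g h : T -> R) (J : (T -> R) -> R).

Definition bounded_measurable f :=
  measurable_fun setT f /\ exists M, forall x, `|f x| <= M.

Lemma bounded_measurable_cst c : bounded_measurable (fun=> c).
Proof. by split=> //; exists `|c|. Qed.

Lemma bounded_measurableD f g : bounded_measurable f -> bounded_measurable g ->
  bounded_measurable (fun x => f x + g x).
Proof.
move=> [mf [M fM]] [mg [N gN]]; split; first exact: measurable_funD.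
by exists (M + N) => x; rewrite (le_trans (ler_normD _ _))// lerD.
Qed.

Lemma bounded_measurableM f g : bounded_measurable f -> bounded_measurable g ->
  bounded_measurable (fun x => f x * g x).
Proof.
move=> [mf [M fM]] [mg [N gN]]; split; first exact: measurable_funM.
by exists (M * N) => x; rewrite normrM ler_pM.
Qed.

Lemma bounded_measurable_indic (A : set T) :
  measurable A -> bounded_measurable \1_A.
Proof.
move=> mA; split; first exact: measurable_indic.
by exists 1 => x; rewrite indicE; case: (_ \in _); rewrite ?normr1 ?normr0.
Qed.

Lemma bounded_measurable_cos f :
  measurable_fun setT f -> bounded_measurable (fun x => cos (f x)).
Proof.
move=> mf; split; last by exists 1 => x; exact: cos_max.
apply: measurableT_comp => //.
exact: (continuous_measurable_fun (@continuous_cos R)).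
Qed.

Lemma bounded_measurable_sin f :
  measurable_fun setT f -> bounded_measurable (fun x => sin (f x)).
Proof.
move=> mf; split; last by exists 1 => x; exact: sin_max.
apply: measurableT_comp => //.
exact: (continuous_measurable_fun (@continuous_sin R)).
Qed.

Lemma bounded_measurable_lim (f_ : nat -> T -> R) f M :
  (forall k, measurable_fun setT (f_ k)) -> (forall k x, `|f_ k x| <= M) ->
  (forall x, f_ ^~ x @ \oo --> f x) -> bounded_measurable f.
Proof.
move=> mf fM cf; split; first exact: (measurable_fun_cvg mf (fun x _ => cf x)).
exists M => x; apply: (cvgr_to_le (cvg_norm (cf x))).
by near=> k; exact: fM.
Unshelve. all: by end_near. Qed.

(** Linearity and bounded convergence are what the proof uses of integration against a finite signed
    measure. They survive linear combinations and weighted pullbacks. *)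
Definition bounded_functional J := [/\
  forall f g, bounded_measurable f -> bounded_measurable g ->
    J (fun x => f x + g x) = J f + J g,
  forall c f, bounded_measurable f -> J (fun x => c * f x) = c * J f &
  forall (f_ : nat -> T -> R) f M,
    (forall k, measurable_fun setT (f_ k)) -> (forall k x, `|f_ k x| <= M) ->
    (forall x, f_ ^~ x @ \oo --> f x) -> J (f_ k) @[k --> \oo] --> J f].

Lemma bounded_functional0 : bounded_functional (fun=> 0).
Proof.
split; [by move=> *; rewrite addr0|by move=> *; rewrite mulr0|].
by move=> *; exact: cvg_cst.
Qed.

Lemma bounded_functionalD J1 J2 : bounded_functional J1 ->
  bounded_functional J2 -> bounded_functional (fun f => J1 f + J2 f).
Proof.
move=> [D1 Z1 C1] [D2 Z2 C2]; split.
- by move=> f g bf bg; rewrite D1// D2//; ring.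
- by move=> c f bf; rewrite Z1// Z2//; ring.
- by move=> f_ f M mf fM cf; apply: cvgD; [exact: C1 cf|exact: C2 cf].
Qed.

Lemma bounded_functionalZ c J : bounded_functional J ->
  bounded_functional (fun f => c * J f).
Proof.
move=> [D1 Z1 C1]; split.
- by move=> f g bf bg; rewrite D1//; ring.
- by move=> k f bf; rewrite Z1//; ring.
- by move=> f_ f M mf fM cf; apply: cvgMl_tmp; exact: C1 cf.
Qed.

Lemma bounded_functionalB J1 J2 : bounded_functional J1 ->
  bounded_functional J2 -> bounded_functional (fun f => J1 f - J2 f).
Proof.
move=> J1P /(bounded_functionalZ (-1)) J2P.
rewrite (_ : (fun f => _) = fun f => J1 f + -1 * J2 f).
  exact: bounded_functionalD.
by apply/funext => f; rewrite mulN1r.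
Qed.

Lemma bounded_functional_sum J (I : Type) (s : seq I) (F : I -> T -> R) :
  bounded_functional J -> (forall i, bounded_measurable (F i)) ->
  bounded_measurable (fun x => \sum_(i <- s) F i x) /\
  J (fun x => \sum_(i <- s) F i x) = \sum_(i <- s) J (F i).
Proof.
move=> [JD JZ _] bF; elim: s => [|i s [IHm IHJ]].
  rewrite big_nil (_ : (fun x => _) = fun=> 0); last first.
    by apply/funext => x; rewrite big_nil.
  split; first exact: bounded_measurable_cst.
  rewrite -[RHS](mul0r (J (fun=> 0))) -JZ; last exact: bounded_measurable_cst.
  by under [in RHS]eq_fun do rewrite mul0r.
rewrite big_cons (_ : (fun x => _) = fun x => F i x + \sum_(j <- s) F j x).
  by split; [exact: bounded_measurableD|rewrite JD// IHJ].
by apply/funext => x; rewrite big_cons.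
Qed.

(** The [k]-th term is 1 exactly when [k < Num.truncn x], so the sum counts the indices below the
    truncation, which is at most [N]. *)
Lemma sum_levels (N : nat) (x : R) : 0 <= x <= N%:R ->
  \sum_(k < N) (k.+1%:R <= x)%R%:R = (Num.truncn x)%:R :> R.
Proof.
move=> /andP[x0 xN].
under eq_bigr do rewrite -truncn_ge_nat//.
have : (Num.truncn x <= N)%N.
  by rewrite -[leqRHS](@natrK R); apply: le_truncn.
move: (Num.truncn x) => m mN; rewrite -natr_sum; congr _%:R.
rewrite -(subnKC mN) big_split_ord /=.
under eq_bigr => i _ do rewrite ltn_ord.
under [X in (_ + X)%N]eq_bigr => i _ do rewrite ltnNge leq_addr.
by rewrite sum1_card card_ord big1 ?addn0.
Qed.

(* Layer-cake approximation: f is the bounded limit of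
   N^-1 * #{k < N | (k + 1) / N <= f}. *)
Lemma bounded_functional_eq J1 J2 :
  bounded_functional J1 -> bounded_functional J2 ->
  (forall A, measurable A -> J1 \1_A = J2 \1_A) ->
  forall f, bounded_measurable f -> J1 f = J2 f.
Proof.
move=> J1P J2P J12.
(* An affine change brings the range of [f] into [0, 1]; the constant [1] needed to undo it is
   itself covered by [unit]. *)
suff unit f : measurable_fun setT f -> (forall x, 0 <= f x <= 1) -> J1 f = J2 f.
  move=> f bf; have [mf [M fM]] := bf.
  (* The added [1] keeps [c] positive when [M] vanishes. *)
  pose c := `|M| + 1.
  have c0 : 0 < c by rewrite ltr_pwDr.
  pose g x := (2 * c)^-1 * (f x + c).
  have bg : bounded_measurable g.
    apply: bounded_measurableM; first exact: bounded_measurable_cst.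
    by apply: bounded_measurableD => //; exact: bounded_measurable_cst.
  have gE : J1 g = J2 g.
    apply: unit => [|x]; first by have [] := bg.
    have fc : `|f x| <= c.
      apply: (le_trans (fM x)); apply: (le_trans (ler_norm M)).
      by rewrite lerDl.
    rewrite /g; move: fc; rewrite ler_norml => /andP[f1 f2].
    have c2 : 0 < 2 * c by rewrite mulr_gt0.
    rewrite mulrC; apply/andP; split; last by rewrite ler_pdivrMr//; lra.
    by rewrite divr_ge0//; lra.
  have fE : f = fun x => 2 * c * g x + - c * 1.
    apply/funext => x; rewrite /g; field; lra.
  have [D1 Z1 _] := J1P; have [D2 Z2 _] := J2P.
  have JE : J1 (fun=> 1) = J2 (fun=> 1).
    by apply: unit => // x; rewrite ler01 lexx.
  have b1 : bounded_measurable (fun=> 1) by exact: bounded_measurable_cst.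
  have b2 : bounded_measurable (fun x => 2 * c * g x).
    exact: (bounded_measurableM (bounded_measurable_cst _) bg).
  have b3 : bounded_measurable (fun=> - c * 1) by exact: bounded_measurable_cst.
  rewrite fE (D1 _ _ b2 b3) (D2 _ _ b2 b3) (Z1 _ _ bg) (Z2 _ _ bg).
  by rewrite (Z1 _ _ b1) (Z2 _ _ b1) gE JE.
move=> mf f01.
pose A N k := [set x | k.+1%:R <= N.+1%:R * f x].
have mA N k : measurable (A N k).
  rewrite -[A N k]setTI; apply: measurable_fun_ler => //.
  by apply: measurable_funM.
pose f_ N x : R := N.+1%:R^-1 * \sum_(k <- index_enum 'I_N.+1) \1_(A N k) x.
have fE N x : f_ N x = N.+1%:R^-1 * (Num.truncn (N.+1%:R * f x))%:R.
  rewrite /f_ -(@sum_levels N.+1).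
    congr (_ * _); apply: eq_bigr => k _; rewrite indicE.
    by congr (nat_of_bool _)%:R; apply/idP/idP; rewrite inE.
  by have /andP[? ?] := f01 x; rewrite mulr_ge0//= ler_piMr.
have bI N (k : 'I_N.+1) : bounded_measurable (\1_(A N k)).
  exact: bounded_measurable_indic.
have mf_ N : measurable_fun setT (f_ N).
  apply: measurable_funM => //.
  by have [[]] := bounded_functional_sum (index_enum 'I_N.+1) J1P (@bI N).
(* Rounding down to a multiple of [N.+1%:R^-1] costs at most one such step. *)
have f_bnd N x : f x - N.+1%:R^-1 <= f_ N x <= f x.
  have /andP[f0 _] := f01 x.
  have /truncn_itv /andP[l u] : 0 <= N.+1%:R * f x by rewrite mulr_ge0.
  rewrite fE [N.+1%:R^-1 * _]mulrC ler_pdivrMr// ler_pdivlMr// mulrBl mulVf//.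
  rewrite ![f x * _]mulrC l andbT lerBlDr natr1 ltW//.
have f_M N x : `|f_ N x| <= 1.
  have /andP[_ f1] := f01 x; have /andP[_ h] := f_bnd N x.
  rewrite ger0_norm ?(le_trans h)//.
  by rewrite fE mulr_ge0.
have cf x : f_ ^~ x @ \oo --> f x.
  apply: (@squeeze_cvgr _ _ _ _ (fun N => f x - N.+1%:R^-1) (fun=> f x)).
  - by near=> N; exact: f_bnd.
  - rewrite -[X in _ --> X]subr0; apply: cvgB; first exact: cvg_cst.
    exact: cvg_harmonic.
  - exact: cvg_cst.
have [_ Z1 C1] := J1P; have [_ Z2 C2] := J2P.
suff E N : J1 (f_ N) = J2 (f_ N).
  have := C2 _ _ _ mf_ f_M cf; under eq_fun do rewrite -E.
  exact: (cvg_unique _ (C1 _ _ _ mf_ f_M cf)).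
have [bS S1] := bounded_functional_sum (index_enum 'I_N.+1) J1P (@bI N).
have [_ S2] := bounded_functional_sum (index_enum 'I_N.+1) J2P (@bI N).
by rewrite Z1// Z2// S1 S2; congr (_ * _); apply: eq_bigr => k _; exact: J12.
Unshelve. all: by end_near. Qed.

Lemma bounded_integrable (m : {finite_measure set T -> \bar R}) f :
  bounded_measurable f -> m.-integrable setT (EFin \o f).
Proof.
move=> [mf [M fM]]; apply: measurable_bounded_integrable => //.
  by rewrite -ge0_fin_numE// fin_num_measure.
exists M; split; first exact: num_real.
by move=> x Mx y _ /=; rewrite (le_trans (fM y))// ltW.
Qed.

Lemma Rintegral_bounded_functional (m : {finite_measure set T -> \bar R}) :
  bounded_functional (Rintegral m setT).
Proof.
split.
- by move=> f g bf bg; rewrite RintegralD//; exact: bounded_integrable.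
- by move=> c f bf; rewrite RintegralZl//; exact: bounded_integrable.
- move=> f_ f M mf fM cf.
  have [_ [M' fM']] := bounded_measurable_lim mf fM cf.
  have bf : bounded_measurable f by exact: bounded_measurable_lim mf fM cf.
  apply: fine_cvg; rewrite fineK; last first.
    by apply: integrable_fin_num => //; exact: bounded_integrable.
  have [] // := @dominated_convergence _ _ _ m setT measurableT
    (fun k => EFin \o f_ k) (EFin \o f) (cst M%:E).
  - by move=> k; exact/measurable_EFinP.
  - by apply/measurable_EFinP; case: bf.
  - apply: aeW => x _; apply: cvg_EFin; last exact: cf.
    by near=> k.
  - by have := bounded_integrable m (bounded_measurable_cst M).
  - by apply: aeW => x k _; rewrite /= lee_fin.
Unshelve. all: by end_near. Qed.

Lemma charge_integral_bounded_functional (nu : {charge set T -> \bar R}) :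
  bounded_functional (charge_integral nu).
Proof. by apply: bounded_functionalB; exact: Rintegral_bounded_functional. Qed.

Lemma charge_integral_indic (nu : {charge set T -> \bar R}) A : measurable A ->
  charge_integral nu \1_A = fine (nu A).
Proof.
move=> mA; rewrite /charge_integral /Rintegral !integral_indic// !setIT.
rewrite [in RHS](jordan_decomp (svalP (hahn_cid nu)))// /cadd /= cscaleN1.
by rewrite fineB// fin_num_measure.
Qed.

(** Indicators determine a bounded functional, so the integral can be computed without looking into
    the arbitrary Hahn decomposition. *)
Lemma charge_integral_eq (nu : {charge set T -> \bar R}) J :
  bounded_functional J -> (forall A, measurable A -> fine (nu A) = J \1_A) ->
  forall f, bounded_measurable f -> charge_integral nu f = J f.
Proof.
move=> JP nuJ; apply: bounded_functional_eq => //.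
  exact: charge_integral_bounded_functional.
by move=> A mA; rewrite charge_integral_indic// nuJ.
Qed.

End BoundedFunctionals.
Arguments bounded_measurable_cst {d T R} c.

(** * Weighted push-forwards *)

Section Pullback.
Context d1 d2 (T1 : measurableType d1) (T2 : measurableType d2) (R : realType).

Lemma bounded_measurable_comp (psi : T1 -> T2) (f : T2 -> R) :
  measurable_fun setT psi -> bounded_measurable f ->
  bounded_measurable (f \o psi).
Proof.
move=> mpsi [mf [M fM]]; split; first exact: measurableT_comp.
by exists M => x; exact: fM.
Qed.

(** This is integration against the image under [psi] of the measure with density [w]. With [psi]
    the identity it restricts or twists a measure; with [psi] a chord end it gives a weighted
    law. *)
Lemma bounded_functional_pullback (J : (T1 -> R) -> R) (psi : T1 -> T2)
    (w : T1 -> R) :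
  bounded_functional J -> measurable_fun setT psi -> bounded_measurable w ->
  bounded_functional (fun f : T2 -> R => J (fun x => w x * f (psi x))).
Proof.
move=> [JD JZ JC] mpsi bw.
have bc f : bounded_measurable f ->
    bounded_measurable (fun x => w x * f (psi x)).
  by move=> /(bounded_measurable_comp mpsi); exact: bounded_measurableM.
split.
- move=> f g bf bg; rewrite -JD; [|exact: bc..].
  by under eq_fun do rewrite mulrDr.
- move=> c f bf; rewrite -JZ; last exact: bc.
  by under eq_fun do rewrite mulrCA.
- move=> f_ f M mf fM cf; have [_ [M' wM]] := bw.
  apply: (JC _ _ (M' * M)).
  + move=> k; have [mw _] := bw.
    by apply: measurable_funM => //; exact: measurableT_comp.
  + by move=> k x; rewrite normrM ler_pM.
  + by move=> x; apply: cvgMl_tmp; exact: cf.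
Qed.

End Pullback.

(** * The Borel sigma-algebra of R^N *)

Lemma measurable_forall_ord d (T : measurableType d) (n : nat)
    (A : 'I_n -> set T) :
  (forall i, measurable (A i)) -> measurable [set x | forall i, A i x].
Proof.
move=> mA; rewrite (_ : [set x | _] = \big[setI/setT]_(i <- enum 'I_n) A i).
  by apply: bigsetI_measurable => i _.
apply/seteqP; split => x; rewrite -bigcap_seq /= => h i; first by move=> _.
by apply: (h i); rewrite /= mem_enum.
Qed.

(** Reconciles the head indices in the equation of the surface with the case analysis by
    [unliftP ord_max]. *)
Lemma widen_ord_lift_max (n : nat) (j : 'I_n) :
  widen_ord (leqnSn n) j = lift ord_max j.
Proof. by apply: val_inj; rewrite /= /bump leqNgt ltn_ord. Qed.

Section BorelRowVectors.
Context {R : realType} {N : nat}.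

Lemma measurable_coord (i : 'I_N) :
  measurable_fun setT (fun u : borel_rV R N => (u : 'rV[R]_N) ord0 i).
Proof.
apply: (measurability _ (RGenOpens.measurableE R)) => _ [_ [a [b ->] <-]].
rewrite setTI; apply: sub_sigma_algebra.
apply: open_comp; last exact: interval_open.
by move=> u _; exact: coord_continuous.
Qed.

(** An open set is the countable union of the rational boxes inside it, and the preimage of a box is
    a finite intersection of conditions on coordinates. The source carries an arbitrary
    sigma-algebra, which later is that of the multiplier sets. *)
Lemma measurable_to_rV d (T : measurableType d) (f : T -> 'rV[R]_N) :
  (forall i, measurable_fun setT (fun x => f x ord0 i)) ->
  measurable_fun setT (f : T -> borel_rV R N).
Proof.
move=> mf.
have mO (O : set (borel_rV R N)) : @open 'rV[R]_N O -> measurable (f @^-1` O).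
  move=> oO.
  pose q (p : 'rV[rat]_N * nat) : 'rV[R]_N := \row_i ratr (p.1 ord0 i).
  pose B (p : 'rV[rat]_N * nat) : set 'rV[R]_N :=
    [set v | forall i, `|q p ord0 i - v ord0 i| < p.2.+1%:R^-1].
  have -> : f @^-1` O =
      \bigcup_p (if `[< B p `<=` O >] then f @^-1` (B p) else set0).
    apply/seteqP; split => [x /= Ox|x [p _]]; last first.
      by case: asboolP => // BO; exact: BO.
    have /nbhs_ballP[e /= e0 eO] : nbhs (f x) O by exact: open_nbhs_nbhs.
    (* Half of [e], as [f x] and the points of the box are compared through the rational centre. *)
    have [m me] : exists m : nat, m.+1%:R^-1 < e / 2.
      have [m _ mP] := near_infty_natSinv_lt (PosNum (divr_gt0 e0 (ltr0n _ 2))).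
      by exists m; exact: (mP m (leqnn m)).
    have hr i : exists r : rat, `|ratr r - f x ord0 i| < m.+1%:R^-1.
      have : f x ord0 i - m.+1%:R^-1 < f x ord0 i + m.+1%:R^-1.
        by rewrite ltrD2l gtrN// invr_gt0.
      move=> /rat_in_itvoo[r]; rewrite in_itv/= => /andP[? ?].
      by exists r; rewrite ltr_distl; apply/andP.
    pose v : 'rV[rat]_N := \row_i projT1 (cid (hr i)).
    have vP : B (v, m) (f x).
      by move=> i; rewrite /q !mxE /=; case: cid.
    exists (v, m) => //; case: asboolP => // -[] w wB; apply: eO.
    split => // i j; rewrite (ord1 i) -ball_normE /=.
    have := wB j; have := vP j; rewrite /=.
    set s := q (v, m) ord0 j => h1 h2.
    rewrite (_ : _ - _ = - (s - f x ord0 j) + (s - w ord0 j)); last by ring.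
    rewrite (le_lt_trans (ler_normD _ _))// normrN [e]splitr.
    by rewrite ltrD// (lt_trans _ me).
  apply: countable_bigcupT_measurable => // p; case: asboolP => // _.
  apply: (@measurable_forall_ord _ _ _
    (fun i => [set x | `|q p ord0 i - f x ord0 i| < p.2.+1%:R^-1])) => i.
  rewrite -[X in measurable X]setTI; apply: measurable_fun_ltr => //.
  by apply: measurableT_comp => //; apply: measurable_funB.
have E : @measurable _ (borel_rV R N) = <<s @open 'rV[R]_N >>.
  by [].
apply: (measurability _ E).
by move=> _ [U oU <-]; rewrite setTI; exact: mO.
Qed.

End BorelRowVectors.

(** * Uniqueness on horizontal hyperplanes *)

Section SignIteration.
Context {R : realType}.

(** The Newton-Schulz iteration for the sign: an odd cubic fixing -1, 0 and 1, with zero derivative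
    at -1 and 1 and repelling at 0. *)
Definition sign_step (x : R) := (3 * x - x ^+ 3) / 2.

Lemma sign_stepN x : sign_step (- x) = - sign_step x.
Proof. by rewrite /sign_step; field. Qed.

(** The gaps in the three inequalities are half of the products in [h1], [h2] and [h3], in this
    order. *)
Lemma sign_step_itv x : 0 < x <= 1 ->
  x <= sign_step x <= 1 /\ 1 - sign_step x <= (1 - x) * (1 - x / 2).
Proof.
move=> /andP[x0 x1].
have h1 : 0 <= x * ((1 - x) * (1 + x)) by rewrite !mulr_ge0//; lra.
have h2 : 0 <= (1 - x) ^+ 2 * (x + 2) by rewrite mulr_ge0 ?sqr_ge0//; lra.
have h3 : 0 <= (1 - x) * x ^+ 2 by rewrite mulr_ge0 ?sqr_ge0//; lra.
by rewrite /sign_step; split; first (apply/andP; split); nra.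
Qed.

Lemma iter_sign_stepN k x : iter k sign_step (- x) = - iter k sign_step x.
Proof. by elim: k => //= k ->; rewrite sign_stepN. Qed.

(** The iterates never drop below [x], so each step shrinks the distance to 1 by a factor of at most
    [1 - x / 2]. *)
Lemma iter_sign_step_itv k x : 0 < x <= 1 ->
  x <= iter k sign_step x <= 1 /\
  1 - iter k sign_step x <= (1 - x / 2) ^+ k.
Proof.
move=> x01; have /andP[x0 x1] := x01.
elim: k => [|k [/andP[IH1 IH2] IH3]].
  by rewrite /= lexx x1 expr0; split=> //; lra.
have [|/andP[h1 h2] h3] := @sign_step_itv (iter k sign_step x).
  by rewrite IH2 (lt_le_trans x0).
rewrite /= h2 (le_trans IH1)//; split => //.
by rewrite (le_trans h3)// exprSr ler_pM//; lra.
Qed.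

Lemma iter_sign_step_norm k x : `|x| <= 1 -> `|iter k sign_step x| <= 1.
Proof.
have pos y : 0 < y <= 1 -> `|iter k sign_step y| <= 1.
  move=> y01; have [/andP[h1 h2] _] := iter_sign_step_itv k y01.
  by have /andP[y0 _] := y01; rewrite ger0_norm// (le_trans (ltW y0)).
have [x0|x0|->] := ltgtP x 0; rewrite ?(gtr0_norm x0) ?(ltr0_norm x0) => x1.
- by rewrite -[x]opprK iter_sign_stepN normrN pos// x1 oppr_gt0 x0.
- by rewrite pos// x0.
- suff -> : iter k sign_step 0 = 0 by rewrite normr0.
  by elim: k {pos} => //= k ->; rewrite /sign_step; ring.
Qed.

Lemma iter_sign_step_cvg x : `|x| <= 1 ->
  iter k sign_step x @[k --> \oo] --> Num.sg x.
Proof.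
have pos y : 0 < y <= 1 -> iter k sign_step y @[k --> \oo] --> (1 : R).
  move=> y01; have /andP[y0 y1] := y01.
  apply: (@squeeze_cvgr _ _ _ _ (fun k => 1 - (1 - y / 2) ^+ k) (fun=> 1)).
  - near=> k; have [/andP[_ ->] h] := iter_sign_step_itv k y01.
    by rewrite andbT; lra.
  - rewrite -[X in _ --> X]subr0; apply: cvgB; first exact: cvg_cst.
    by apply: cvg_expr; rewrite ger0_norm; lra.
  - exact: cvg_cst.
have [x0|x0|->] := ltgtP x 0; rewrite ?(gtr0_norm x0) ?(ltr0_norm x0) => x1.
- rewrite ltr0_sg// -[x]opprK; under eq_fun do rewrite iter_sign_stepN.
  by apply: cvgN; apply: pos; rewrite oppr_gt0 x0.
- by rewrite gtr0_sg//; apply: pos; rewrite x0.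
- rewrite sgr0 (_ : (fun k => _) = fun=> 0); first exact: cvg_cst.
  by apply/funext; elim=> //= k ->; rewrite /sign_step; ring.
Unshelve. all: by end_near. Qed.

(** Once [a / m.+1%:R] lies strictly between [- pi] and [pi], its sine has the sign of [a], so the
    sequence is eventually constant. *)
Lemma sg_sin_cvg (a : R) :
  Num.sg (sin (a / m.+1%:R)) @[m --> \oo] --> Num.sg a.
Proof.
have pos (b : R) : 0 < b -> \forall m \near \oo, Num.sg (sin (b / m.+1%:R)) = 1.
  move=> b0; near=> m; apply: gtr0_sg; apply: sin_gt0_pi.
  rewrite divr_gt0// ltr_pdivrMr// -ltr_pdivrMl ?pi_gt0//.
  rewrite (lt_le_trans (_ : _ < m%:R)) ?ler_nat//.
  by near: m; exact: nbhs_infty_gtr.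
apply: cvg_near_cst; have [a0|a0|->] := ltgtP a 0.
- have := pos (- a); rewrite oppr_gt0 => /(_ a0); apply: filterS => m.
  rewrite mulNr sinN sgrN => h; apply/eqP.
  by rewrite (ltr0_sg a0) -[X in X == _]opprK h.
- by rewrite (gtr0_sg a0); exact: pos.
- by near=> m; rewrite mul0r sin0.
Unshelve. all: by end_near. Qed.

End SignIteration.

(** * Multipliers of measures with vanishing Fourier transform *)

Section Multipliers.
Context d (T : measurableType d) (R : realType) (n : nat).
Variables (y : 'I_n -> T -> R) (z : T -> R) (J1 J2 : (T -> R) -> R).
Hypothesis my : forall i, measurable_fun setT (y i).
Hypothesis mz : measurable_fun setT z.
Hypothesis J1P : bounded_functional J1.
Hypothesis J2P : bounded_functional J2.

(** Letting [theta] vary makes a single real equation carry both parts of a complex one: a quarter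
    turn exchanges them up to sign. *)
Definition phase (xi : 'I_n -> R) (theta : R) (x : T) : R :=
  \sum_(i < n) xi i * y i x + z x + theta.

(* J1 and J2 stand for the integrals against the real and imaginary part of a
   complex measure nu, and the equation says that e^{- i z} h d(nu) has a
   vanishing Fourier transform in the variables y. *)
Definition annihilates (h : T -> R) := bounded_measurable h /\
  forall xi theta, J1 (fun x => h x * cos (phase xi theta x)) +
                   J2 (fun x => h x * sin (phase xi theta x)) = 0.

Definition multiplier (f : T -> R) := bounded_measurable f /\
  forall h, annihilates h -> annihilates (fun x => f x * h x).

Lemma measurable_linear_form (xi : 'I_n -> R) :
  measurable_fun setT (fun x => \sum_(i < n) xi i * y i x).
Proof. by apply: measurable_sum => i; apply: measurable_funM. Qed.

Lemma measurable_phase xi theta : measurable_fun setT (phase xi theta).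
Proof.
apply: measurable_funD => //; apply: measurable_funD => //.
exact: measurable_linear_form.
Qed.

Lemma bounded_cos_phase xi theta :
  bounded_measurable (fun x => cos (phase xi theta x)).
Proof. exact/bounded_measurable_cos/measurable_phase. Qed.

Lemma bounded_sin_phase xi theta :
  bounded_measurable (fun x => sin (phase xi theta x)).
Proof. exact/bounded_measurable_sin/measurable_phase. Qed.

Lemma annihilatesD g h : annihilates g -> annihilates h ->
  annihilates (fun x => g x + h x).
Proof.
have [D1 _ _] := J1P; have [D2 _ _] := J2P.
move=> [bg g0] [bh h0]; split; first exact: bounded_measurableD.
move=> xi theta; have bc := bounded_cos_phase xi theta.
have bs := bounded_sin_phase xi theta.
under eq_fun do rewrite mulrDl; under [in X in _ + X]eq_fun do rewrite mulrDl.
rewrite (D1 _ _ (bounded_measurableM bg bc) (bounded_measurableM bh bc)).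
rewrite (D2 _ _ (bounded_measurableM bg bs) (bounded_measurableM bh bs)).
by rewrite addrACA g0 h0 addr0.
Qed.

Lemma annihilatesZ c h : annihilates h -> annihilates (fun x => c * h x).
Proof.
have [_ Z1 _] := J1P; have [_ Z2 _] := J2P.
move=> [bh h0]; split.
  exact: (bounded_measurableM (bounded_measurable_cst c) bh).
move=> xi theta; have bc := bounded_cos_phase xi theta.
have bs := bounded_sin_phase xi theta.
under eq_fun do rewrite -mulrA; under [in X in _ + X]eq_fun do rewrite -mulrA.
rewrite (Z1 _ _ (bounded_measurableM bh bc)).
by rewrite (Z2 _ _ (bounded_measurableM bh bs)) -mulrDr h0 mulr0.
Qed.

Lemma annihilates_lim (h_ : nat -> T -> R) h M :
  (forall k, annihilates (h_ k)) -> (forall k x, `|h_ k x| <= M) ->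
  (forall x, h_ ^~ x @ \oo --> h x) -> annihilates h.
Proof.
have [_ _ C1] := J1P; have [_ _ C2] := J2P.
move=> ah hM ch.
have mh k : measurable_fun setT (h_ k) by have [[]] := ah k.
split; first exact: bounded_measurable_lim mh hM ch.
move=> xi theta.
have bnd (c : R) k x : `|c| <= 1 -> `|h_ k x * c| <= M.
  by move=> c1; rewrite normrM (le_trans _ (hM k x))// ler_piMr.
have c1 : J1 (fun x => h_ k x * cos (phase xi theta x)) @[k --> \oo] -->
          J1 (fun x => h x * cos (phase xi theta x)).
  apply: (C1 _ _ M) => [k|k x|x].
  - by apply: measurable_funM => //; case: (bounded_cos_phase xi theta).
  - exact: (bnd _ _ _ (cos_max _)).
  - by apply: cvgM; [exact: ch|exact: cvg_cst].
have c2 : J2 (fun x => h_ k x * sin (phase xi theta x)) @[k --> \oo] -->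
          J2 (fun x => h x * sin (phase xi theta x)).
  apply: (C2 _ _ M) => [k|k x|x].
  - by apply: measurable_funM => //; case: (bounded_sin_phase xi theta).
  - exact: (bnd _ _ _ (sin_max _)).
  - by apply: cvgM; [exact: ch|exact: cvg_cst].
have c0 : J1 (fun x => h_ k x * cos (phase xi theta x)) +
          J2 (fun x => h_ k x * sin (phase xi theta x))
          @[k --> \oo] --> (0 : R).
  by apply: cvg_near_cst; near=> k; exact: (ah k).2.
exact: (cvg_unique _ (cvgD c1 c2) c0).
Unshelve. all: by end_near. Qed.

Lemma multiplier_cst c : multiplier (fun=> c).
Proof.
split; first exact: bounded_measurable_cst.
by move=> h; exact: annihilatesZ.
Qed.

Lemma multiplierD f g : multiplier f -> multiplier g ->
  multiplier (fun x => f x + g x).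
Proof.
move=> [bf fP] [bg gP]; split; first exact: bounded_measurableD.
move=> h ah; under eq_fun do rewrite mulrDl.
by apply: annihilatesD; [exact: fP|exact: gP].
Qed.

Lemma multiplierM f g : multiplier f -> multiplier g ->
  multiplier (fun x => f x * g x).
Proof.
move=> [bf fP] [bg gP]; split; first exact: bounded_measurableM.
by move=> h ah; under eq_fun do rewrite -mulrA; exact/fP/gP.
Qed.

Lemma multiplier_lim (f_ : nat -> T -> R) f M :
  (forall k, multiplier (f_ k)) -> (forall k x, `|f_ k x| <= M) ->
  (forall x, f_ ^~ x @ \oo --> f x) -> multiplier f.
Proof.
move=> mf fM cf; split.
  by apply: bounded_measurable_lim fM cf => k; have [[]] := mf k.
move=> h ah; have [[_ [N hN]] _] := ah.
apply: (@annihilates_lim (fun k x => f_ k x * h x) _ (M * N)).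
- by move=> k; exact: (mf k).2.
- by move=> k x; rewrite normrM ler_pM.
- by move=> x; apply: cvgM; [exact: cf|exact: cvg_cst].
Qed.

Lemma phaseD (xi eta : 'I_n -> R) theta a x :
  phase (fun i => xi i + eta i) (theta + a) x =
  phase xi theta x + (\sum_(i < n) eta i * y i x + a).
Proof.
rewrite /phase; under eq_bigr do rewrite mulrDl.
by rewrite big_split/=; ring.
Qed.

Lemma phaseB (xi eta : 'I_n -> R) theta a x :
  phase (fun i => xi i - eta i) (theta - a) x =
  phase xi theta x - (\sum_(i < n) eta i * y i x + a).
Proof.
rewrite /phase; under eq_bigr do rewrite mulrBl.
by rewrite big_split/= sumrN; ring.
Qed.

(** By the product-to-sum formulas, multiplying by this cosine averages the equations at the
    frequencies [xi + eta] and [xi - eta], both of which hold for [h]. *)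
Lemma multiplier_cos (eta : 'I_n -> R) a :
  multiplier (fun x => cos (\sum_(i < n) eta i * y i x + a)).
Proof.
have bc : bounded_measurable (fun x => cos (\sum_(i < n) eta i * y i x + a)).
  apply: bounded_measurable_cos; apply: measurable_funD => //.
  exact: measurable_linear_form.
split => // h [bh h0]; split; first exact: bounded_measurableM.
have [D1 Z1 _] := J1P; have [D2 Z2 _] := J2P.
move=> xi theta.
pose xiD i := xi i + eta i; pose xiB i := xi i - eta i.
have bcD := bounded_measurableM bh (bounded_cos_phase xiD (theta + a)).
have bcB := bounded_measurableM bh (bounded_cos_phase xiB (theta - a)).
have bsD := bounded_measurableM bh (bounded_sin_phase xiD (theta + a)).
have bsB := bounded_measurableM bh (bounded_sin_phase xiB (theta - a)).
have -> : (fun x => cos (\sum_(i < n) eta i * y i x + a) * h x *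
                    cos (phase xi theta x)) =
    fun x => 2^-1 * (h x * cos (phase xiD (theta + a) x) +
                     h x * cos (phase xiB (theta - a) x)).
  by apply/funext => x; rewrite phaseD phaseB cosD cosB; field.
have -> : (fun x => cos (\sum_(i < n) eta i * y i x + a) * h x *
                    sin (phase xi theta x)) =
    fun x => 2^-1 * (h x * sin (phase xiD (theta + a) x) +
                     h x * sin (phase xiB (theta - a) x)).
  by apply/funext => x; rewrite phaseD phaseB sinD sinB; field.
rewrite (Z1 _ _ (bounded_measurableD bcD bcB)) (D1 _ _ bcD bcB).
rewrite (Z2 _ _ (bounded_measurableD bsD bsB)) (D2 _ _ bsD bsB).
by rewrite -mulrDr addrACA !h0 addr0 mulr0.
Qed.

(** Each iterate of [sign_step] is a polynomial in [f], hence a multiplier, and the iterates stay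
    bounded by 1. *)
Lemma multiplier_sg f : multiplier f -> (forall x, `|f x| <= 1) ->
  multiplier (fun x => Num.sg (f x)).
Proof.
move=> mf f1.
apply: (@multiplier_lim (fun k x => iter k sign_step (f x)) _ 1).
- elim=> [|k IH] //=.
  have -> : (fun x => sign_step (iter k sign_step (f x))) =
     fun x => 3 / 2 * iter k sign_step (f x) +
       - 2^-1 * (iter k sign_step (f x) * (iter k sign_step (f x) *
                 iter k sign_step (f x))).
    by apply/funext => x; rewrite /sign_step; field.
  by apply: multiplierD; apply: multiplierM => //;
    [exact: multiplier_cst|exact: multiplier_cst|do 2 apply: multiplierM => //].
- by move=> k x; exact: iter_sign_step_norm.
- by move=> x; exact: iter_sign_step_cvg.
Qed.

Lemma multiplier_sg_coord (i : 'I_n) a :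
  multiplier (fun x => Num.sg (y i x - a)).
Proof.
apply: (@multiplier_lim (fun m x => Num.sg (sin ((y i x - a) / m.+1%:R))) _ 1).
- move=> m; apply: multiplier_sg; last by move=> x; exact: sin_max.
  (* The frequency vector is supported at [i], and the shift by [- pi / 2] turns the cosine into a
     sine. *)
  have -> : (fun x => sin ((y i x - a) / m.+1%:R)) =
    fun x => cos (\sum_(j < n) (if j == i then m.+1%:R^-1 else 0) * y j x +
                  (- a / m.+1%:R - pi / 2)).
    apply/funext => x; rewrite (bigD1 i)//= eqxx big1 ?addr0; last first.
      by move=> j /negbTE ->; rewrite mul0r.
    rewrite -sinDpihalf; congr sin; field.
    by rewrite nat1r pnatr_eq0.
  exact: multiplier_cos.
- by move=> m x; rewrite normr_sg; case: (_ != _).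
- by move=> x; exact: sg_sin_cvg.
Qed.

Definition multiplier_sets : set (set T) :=
  [set A | measurable A /\ multiplier \1_A].

Lemma multiplier_sets_sigma_algebra : sigma_algebra setT multiplier_sets.
Proof.
split.
- by split => //; rewrite indic0; exact: multiplier_cst.
- move=> A [mA iA]; split; first exact: measurableD.
  rewrite setTD (_ : \1_(~` A) = fun x => 1 + -1 * \1_A x).
    by apply: multiplierD; [|apply: multiplierM => //]; exact: multiplier_cst.
  apply/funext => x; rewrite !indicE in_setC; case: (x \in A) => /=; ring.
- move=> F FP; split; first by apply: bigcupT_measurable => k; exact: (FP k).1.
  (* One minus the product of the complementary indicators is the indicator of the union of the
     first [N] sets, even if they overlap. At each point it is eventually constant in [N]. *)
  apply: (@multiplier_lim
    (fun N x => 1 + -1 * \prod_(k < N) (1 + -1 * \1_(F k) x)) _ 1).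
  + move=> N; apply: multiplierD; first exact: multiplier_cst.
    apply: multiplierM; first exact: multiplier_cst.
    elim: N => [|N IH].
      by under eq_fun do rewrite big_ord0; exact: multiplier_cst.
    under eq_fun do rewrite big_ord_recr/=; apply: multiplierM => //.
    apply: multiplierD; first exact: multiplier_cst.
    by apply: multiplierM; [exact: multiplier_cst|exact: (FP N).2].
  + move=> N x.
    have F01 k : (0 : R) <= 1 + -1 * \1_(F k) x <= (1 : R).
      by rewrite indicE; case: (_ \in _); apply/andP; split; rewrite /=; lra.
    have p0 : 0 <= \prod_(k < N) (1 + -1 * \1_(F k) x) :> R.
      by apply: prodr_ge0 => k _; have /andP[] := F01 k.
    have p1 : \prod_(k < N) (1 + -1 * \1_(F k) x) <= 1 :> R.
      by apply: prodr_ile1 => k _; exact: F01.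
    by rewrite ger0_norm; lra.
  + move=> x; apply: cvg_near_cst.
    have [[k0 _ Fk0]|nF] := pselect ((\bigcup_k F k) x).
      near=> N; have kN : (k0 < N)%N by near: N; exact: nbhs_infty_gt.
      rewrite (bigD1 (Ordinal kN))//= !indicE !mem_set//; last by exists k0.
      by rewrite /=; ring.
    near=> N; rewrite big1.
      by rewrite indicE memNset//=; ring.
    move=> k _; rewrite indicE memNset ?mulr0 ?addr0// => Fk.
    by apply: nF; exists k.
Unshelve. all: by end_near. Qed.

Notation T' := (g_sigma_algebraType multiplier_sets).

Lemma measurable_multiplier_sets (A : set T) :
  @measurable _ T' A = multiplier_sets A.
Proof.
rewrite -[in RHS](sigma_algebra_id multiplier_sets_sigma_algebra) //.
Qed.

Lemma multiplier_set_coord (i : 'I_n) : measurable_fun setT (y i : T' -> R).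
Proof.
apply: (measurability _ (RGenOInfty.measurableE R)) => _ [_ [a ->] <-].
rewrite setTI measurable_multiplier_sets; split.
  by rewrite -[X in measurable X]setTI; apply: my => //; exact: measurable_itv.
(* If s is the sign of [y i x - a], then (s + s^2) / 2 is 1 for s = 1 and 0 for s = 0 or s = -1. *)
have -> : \1_(y i @^-1` `]a, +oo[) =
    fun x => 2^-1 * (Num.sg (y i x - a) +
                     Num.sg (y i x - a) * Num.sg (y i x - a)).
  apply/funext => x; rewrite indicE.
  have [h|h|h] := ltgtP (y i x) a.
  - rewrite ltr0_sg ?subr_lt0// memNset/=; first by field.
    by rewrite in_itv/= andbT; apply/negP; rewrite -leNgt ltW.
  - rewrite gtr0_sg ?subr_gt0// mem_set/=; first by field.
    by rewrite in_itv/= h.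
  - rewrite h subrr sgr0 memNset/=; first by field.
    by rewrite in_itv/= h ltxx.
have ms := multiplier_sg_coord i a.
apply: multiplierM; first exact: multiplier_cst.
by apply: multiplierD => //; exact: multiplierM.
Qed.

(** Every bounded function cut off to [A] integrates to 0, so the product with [\1_A] is annihilated
    whatever [h] is. This takes care of the sets off the surface. *)
Lemma multiplier_set_null (A : set T) : measurable A ->
  (forall B, measurable B -> B `<=` A -> J1 \1_B = 0 /\ J2 \1_B = 0) ->
  multiplier_sets A.
Proof.
move=> mA A0.
have null (J : (T -> R) -> R) f : bounded_functional J ->
    (forall B, measurable B -> B `<=` A -> J \1_B = 0) ->
    bounded_measurable f -> J (fun x => \1_A x * f x) = 0.
  move=> JP J0 bf.
  have bA := bounded_measurable_indic R mA.
  have JAP := bounded_functional_pullback JP (@measurable_id _ T setT) bA.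
  apply: (bounded_functional_eq JAP (bounded_functional0 _ _)) => // B mB.
  rewrite (_ : (fun x => _) = \1_(A `&` B)); last first.
    by apply/funext => x; rewrite indicI.
  by apply: J0; [exact: measurableI|exact: subIsetl].
split => //; split; first exact: bounded_measurable_indic.
move=> h [bh _]; split.
  by apply: bounded_measurableM => //; exact: bounded_measurable_indic.
move=> xi theta.
under eq_fun do rewrite -mulrA; under [in X in _ + X]eq_fun do rewrite -mulrA.
rewrite !null ?addr0//.
- by move=> B mB BA; have [] := A0 B mB BA.
- exact: (bounded_measurableM bh (bounded_sin_phase xi theta)).
- by move=> B mB BA; have [] := A0 B mB BA.
- exact: (bounded_measurableM bh (bounded_cos_phase xi theta)).
Qed.

(** At frequency 0 the multipliers [\1_A] show that the measure e^{- i z} d(nu) vanishes on all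
    sets; multiplying back by e^{i z} then gives nu = 0. *)
Lemma annihilates_cst1_null :
  (forall A, measurable A -> multiplier_sets A) -> annihilates (fun=> 1) ->
  forall A, measurable A -> J1 \1_A = 0 /\ J2 \1_A = 0.
Proof.
move=> mult a1.
have phase0 theta x : phase (fun=> 0) theta x = z x + theta.
  by rewrite /phase big1 ?add0r// => i _; rewrite mul0r.
have JE theta f : bounded_measurable f ->
    J1 (fun x => cos (z x + theta) * f x) +
    J2 (fun x => sin (z x + theta) * f x) = 0.
  have bc : bounded_measurable (fun x => cos (z x + theta)).
    by apply: bounded_measurable_cos; exact: measurable_funD.
  have bs : bounded_measurable (fun x => sin (z x + theta)).
    by apply: bounded_measurable_sin; exact: measurable_funD.
  have J1c := bounded_functional_pullback J1P (@measurable_id _ T setT) bc.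
  have J2s := bounded_functional_pullback J2P (@measurable_id _ T setT) bs.
  apply: (bounded_functional_eq (bounded_functionalD J1c J2s)
    (bounded_functional0 _ _)) => A mA.
  have [_ [_ /(_ _ a1)[_ /(_ (fun=> 0) theta)]]] := mult A mA.
  by under eq_fun do rewrite mulr1 phase0 mulrC;
    under [in X in _ + X]eq_fun do rewrite mulr1 phase0 mulrC.
have [D1 Z1 _] := J1P; have [D2 Z2 _] := J2P.
move=> A mA.
have bA := bounded_measurable_indic R mA.
have bc := bounded_measurable_cos mz.
have bs := bounded_measurable_sin mz.
have bcc := bounded_measurableM bc (bounded_measurableM bc bA).
have bcs := bounded_measurableM bc (bounded_measurableM bs bA).
have bss := bounded_measurableM bs (bounded_measurableM bs bA).
(* Writing [\1_A] as (cos^2 + sin^2) [\1_A], the sum of [E1] and [E2] is [J1 \1_A] and that of [E3]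
   and [E4] is [J2 \1_A]; the mixed terms cancel. *)
have E1 := JE 0 _ (bounded_measurableM bc bA).
have E2 := JE (- (pi / 2)) _ (bounded_measurableM bs bA).
have E3 := JE 0 _ (bounded_measurableM bs bA).
have E4 := JE (pi / 2) _ (bounded_measurableM bc bA).
have AE : \1_A = fun x => cos (z x) * (cos (z x) * \1_A x) +
                          sin (z x) * (sin (z x) * \1_A x).
  by apply/funext => x; rewrite !mulrA -mulrDl -!expr2 cos2Dsin2 mul1r.
split.
- rewrite AE (D1 _ _ bcc bss).
  move: E1 E2.
  under eq_fun do rewrite addr0.
  under [in X in _ + X = _ -> _]eq_fun do rewrite addr0 mulrCA.
  under [in X in _ -> X + _ = _ -> _]eq_fun do
    rewrite cosB cos_pihalf sin_pihalf mulr0 add0r mulr1.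
  under [in X in _ -> _ + X = _ -> _]eq_fun do
    rewrite sinB cos_pihalf sin_pihalf mulr0 sub0r mulr1 -mulN1r -mulrA.
  by rewrite (Z2 _ _ bcs) => e1 e2; lra.
- rewrite AE (D2 _ _ bcc bss).
  move: E3 E4.
  under eq_fun do rewrite addr0.
  under [in X in _ + X = _ -> _]eq_fun do rewrite addr0.
  under [in X in _ -> X + _ = _ -> _]eq_fun do
    rewrite cosD cos_pihalf sin_pihalf mulr0 sub0r mulr1 -mulN1r -mulrA
      (mulrCA (sin _)).
  under [in X in _ -> _ + X = _ -> _]eq_fun do
    rewrite sinD cos_pihalf sin_pihalf mulr0 add0r mulr1.
  by rewrite (Z1 _ _ bcs) => e1 e2; lra.
Qed.

End Multipliers.

(** * Horizontal hyperplanes determine the measure *)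

Section Sufficiency.
Context {R : realType} {n : nat}.

Lemma measurable_dotv N (x : 'rV[R]_N) :
  measurable_fun setT (fun u : borel_rV R N => dotv x u).
Proof.
apply: measurable_sum => i; apply: measurable_funM => //.
exact: measurable_coord.
Qed.

Lemma bounded_cos_dotv N (x : 'rV[R]_N) :
  bounded_measurable (fun u : borel_rV R N => cos (pi * dotv x u)).
Proof.
apply: bounded_measurable_cos; apply: measurable_funM => //.
exact: measurable_dotv.
Qed.

Lemma bounded_sin_dotv N (x : 'rV[R]_N) :
  bounded_measurable (fun u : borel_rV R N => sin (pi * dotv x u)).
Proof.
apply: bounded_measurable_sin; apply: measurable_funM => //.
exact: measurable_dotv.
Qed.

Lemma fourierE (mu : complex_measure (borel_rV R n.+1) R) (x : 'rV[R]_n.+1) :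
  let C nu :=
    charge_integral nu (fun u : borel_rV R n.+1 => cos (pi * dotv x u)) in
  let S nu :=
    charge_integral nu (fun u : borel_rV R n.+1 => sin (pi * dotv x u)) in
  fourier mu x = ((C (re_charge mu) + S (im_charge mu)) +i*
                  (C (im_charge mu) - S (re_charge mu)))%C.
Proof.
move=> C S; rewrite /fourier /complex_integral /=.
have E nu : charge_integral nu
    (fun u : borel_rV R n.+1 => - sin (pi * dotv x u)) = - S nu.
  have [_ Z _] := charge_integral_bounded_functional nu.
  rewrite -mulN1r -Z; last exact: bounded_sin_dotv.
  by under eq_fun do rewrite -mulN1r.
by rewrite !E opprK [in X in (_ +i* X)%C]addrC.
Qed.

Local Notation head_coord i := (fun u : borel_rV R n.+1 =>
  (u : 'rV[R]_n.+1) ord0 (widen_ord (leqnSn n) i)).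
Local Notation last_coord := (fun u : borel_rV R n.+1 =>
  (u : 'rV[R]_n.+1) ord0 ord_max).
Local Notation height :=
  (fun u : borel_rV R n.+1 => \sum_(i < n) expR (head_coord i u ^+ 2)).

Lemma measurable_surface :
  measurable (@exp_square_surface R n : set (borel_rV R n.+1)).
Proof.
have ml : measurable_fun setT last_coord by exact: measurable_coord.
have mh : measurable_fun setT height.
  apply: measurable_sum => i; apply: measurableT_comp => //.
  by apply: measurable_funX; exact: measurable_coord.
have := measurable_fun_eqr ml mh measurableT (I : measurable [set true]).
rewrite setTI; congr measurable.
by apply/seteqP; split => u; rewrite /exp_square_surface /=; move/eqP.
Qed.

Lemma parallel_uniqueness (c : R) :
  heisenberg_uniqueness_pair (@exp_square_surface R n)
    [set x | x ord0 ord_max = c].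
Proof.
move=> mu supp _ F0.
pose T := borel_rV R n.+1.
pose y (i : 'I_n) : T -> R := head_coord i.
pose z : T -> R := fun u => pi * (c * last_coord u).
pose J1 := @charge_integral _ T R (re_charge mu).
pose J2 := @charge_integral _ T R (im_charge mu).
have J1P : bounded_functional J1 := charge_integral_bounded_functional _.
have J2P : bounded_functional J2 := charge_integral_bounded_functional _.
have my i : measurable_fun setT (y i) by exact: measurable_coord.
have mlast : measurable_fun setT (last_coord : T -> R).
  exact: measurable_coord.
have mz : measurable_fun setT z.
  by apply: measurable_funM => //; exact: measurable_funM.
(* The support hypothesis makes every Borel set off the surface null. *)
have G0 : multiplier_sets y z J1 J2 (~` (@exp_square_surface R n)).
  apply: multiplier_set_null => //; first exact: measurableC measurable_surface.
  move=> B mB BG; rewrite /J1 /J2 !charge_integral_indic//.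
  have := supp B mB; rewrite disjoints_subset => /(_ BG) h.
  by split; [have := congr1 (@complex.Re _) h|have := congr1 (@complex.Im _) h].
have sigA := multiplier_sets_sigma_algebra my mz J1P J2P.
pose T' := g_sigma_algebraType (multiplier_sets y z J1 J2).
have mE (A : set T) : @measurable _ T' A = multiplier_sets y z J1 J2 A.
  exact: measurable_multiplier_sets.
have my' i : measurable_fun setT (y i : T' -> R) by exact: multiplier_set_coord.
have mheight : measurable_fun setT (height : T' -> R).
  apply: measurable_sum => i; apply: measurableT_comp => //.
  by apply: measurable_funX; exact: my'.
have mG : @measurable _ T' (@exp_square_surface R n).
  by rewrite -[X in measurable X]setCK; apply: measurableC; rewrite mE.
(* On the surface the last coordinate is the height, a function of the head coordinates; what
   remains lies off the surface and is null. *)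
have mlast' : measurable_fun setT (last_coord : T' -> R).
  apply: (measurability _ (RGenOInfty.measurableE R)) => _ [_ [a ->] <-].
  rewrite setTI.
  have -> : last_coord @^-1` `]a, +oo[ =
    (height @^-1` `]a, +oo[ `&` (@exp_square_surface R n)) `|`
    (last_coord @^-1` `]a, +oo[ `&` ~` (@exp_square_surface R n)).
    apply/seteqP; split => [u ua|u [[ua uG]|[]]//].
      have [uG|uG] := pselect (exp_square_surface u); [left|by right].
      by split => //; move: ua; rewrite /= uG.
    by rewrite /= uG.
  apply: measurableU.
    apply: measurableI => //; rewrite -[X in measurable X]setTI.
    by apply: mheight => //; exact: measurable_itv.
  rewrite mE; apply: multiplier_set_null => //.
    apply: measurableI; last exact: measurableC measurable_surface.
    rewrite -[X in measurable X]setTI.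
    by apply: mlast => //; exact: measurable_itv.
  move=> B mB /subset_trans/(_ (@subIsetr _ _ _)) BG.
  rewrite /J1 /J2 !charge_integral_indic//.
  have := supp B mB; rewrite disjoints_subset => /(_ BG) h.
  by split; [have := congr1 (@complex.Re _) h|have := congr1 (@complex.Im _) h].
(* Measurability of the identity says that every Borel set is a multiplier set. *)
have mid : measurable_fun setT (id : T' -> T).
  apply: measurable_to_rV => i.
  have [j ->|->] := unliftP ord_max i; last exact: mlast'.
  by rewrite -widen_ord_lift_max; exact: my'.
have mult (A : set T) : measurable A -> multiplier_sets y z J1 J2 A.
  by move=> mA; rewrite -mE -[X in measurable X]setTI; exact: mid.
have a1 : annihilates y z J1 J2 (fun=> 1).
  split; first exact: bounded_measurable_cst.
  move=> xi theta.
  (* This is the point of the hyperplane whose frequencies are [xi]; the division by [pi] offsets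
     the factor in the Fourier kernel. *)
  pose x : 'rV[R]_n.+1 :=
    \row_i (if unlift ord_max i is Some j then xi j / pi else c).
  have xj (j : 'I_n) : x ord0 (widen_ord (leqnSn n) j) = xi j / pi.
    by rewrite widen_ord_lift_max mxE liftK.
  have xl : x ord0 ord_max = c by rewrite mxE unlift_none.
  have phaseE (u : T) : phase y z xi theta u = pi * dotv x u + theta.
    rewrite /phase /dotv big_ord_recr/= xl mulrDr mulr_sumr.
    congr (_ + _ + _); apply: eq_bigr => i _; rewrite xj mulrA [pi * _]mulrC.
    by rewrite divfK// gt_eqF// pi_gt0.
  have := F0 x xl; rewrite fourierE => h.
  have := congr1 (@complex.Im _) h; have {h} := congr1 (@complex.Re _) h.
  rewrite /= -/J1 -/J2 => h1 h2.
  have [D1 Z1 _] := J1P; have [D2 Z2 _] := J2P.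
  have bc : bounded_measurable (fun u : T => cos (pi * dotv x u)).
    exact: bounded_cos_dotv.
  have bs : bounded_measurable (fun u : T => sin (pi * dotv x u)).
    exact: bounded_sin_dotv.
  have bZ k (f : T -> R) : bounded_measurable f ->
      bounded_measurable (fun u => k * f u).
    by move=> bf; exact: (bounded_measurableM (bounded_measurable_cst k) bf).
  have -> : (fun u => 1 * cos (phase y z xi theta u)) =
      fun u => cos theta * cos (pi * dotv x u) +
               - sin theta * sin (pi * dotv x u).
    by apply/funext => u; rewrite phaseE cosD; ring.
  have -> : (fun u => 1 * sin (phase y z xi theta u)) =
      fun u => cos theta * sin (pi * dotv x u) +
               sin theta * cos (pi * dotv x u).
    by apply/funext => u; rewrite phaseE sinD; ring.
  rewrite (D1 _ _ (bZ _ _ bc) (bZ _ _ bs)) (D2 _ _ (bZ _ _ bs) (bZ _ _ bc)).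
  rewrite (Z1 _ _ bc) (Z1 _ _ bs) (Z2 _ _ bc) (Z2 _ _ bs).
  have -> : J1 (fun u : T => cos (pi * dotv x u)) =
            - J2 (fun u : T => sin (pi * dotv x u)).
    by apply/eqP; rewrite -addr_eq0 h1.
  have -> : J2 (fun u : T => cos (pi * dotv x u)) =
            J1 (fun u : T => sin (pi * dotv x u)).
    by apply/eqP; rewrite -subr_eq0 h2.
  by ring.
move=> A mA.
have [] := annihilates_cst1_null mz J1P J2P mult a1 mA.
rewrite /J1 /J2 !charge_integral_indic// => r0 i0.
by rewrite /complex_measure_fun r0 i0.
Qed.

End Sufficiency.

(** * Failure of uniqueness on the other hyperplanes *)

Section ChargeOfFunctional.
Context d (T : measurableType d) (R : realType).
Variable J : (T -> R) -> R.
Hypothesis JP : bounded_functional J.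

Definition functional_charge (A : set T) : \bar R := (J \1_A)%:E.

Let functional_charge0 : functional_charge set0 = 0%E.
Proof.
have [_ Z _] := JP; rewrite /functional_charge indic0; congr EFin.
rewrite -[RHS](mul0r (J (cst 0))) -Z; last exact: bounded_measurable_cst.
by congr J; apply/funext => x; rewrite mul0r.
Qed.

Let functional_charge_fin A : measurable A -> functional_charge A \is a fin_num.
Proof. by []. Qed.

(** By disjointness the partial sums of indicators are indicators of partial unions, hence bounded
    by 1, and at each point they are eventually constant. *)
Let functional_charge_sigma_additive : semi_sigma_additive functional_charge.
Proof.
move=> F mF tF mUF; have [_ _ C] := JP.
rewrite (_ : (fun m => _) =
    EFin \o (fun m => J (fun x => \sum_(i < m) \1_(F i) x))); last first.
  apply/funext => m /=; rewrite /functional_charge sumEFin; congr EFin.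
  rewrite big_mkord.
  by have [_ ->] := bounded_functional_sum (index_enum 'I_m) JP
    (fun i : 'I_m => bounded_measurable_indic R (mF i)).
apply: cvg_EFin; first by near=> m.
have sumE m x : \sum_(i < m) \1_(F i) x = \1_(\bigcup_(i < m) F i) x :> R.
  rewrite [RHS]indicE; have [|] := boolP (_ \in _).
    rewrite inE => -[i /= im Fi].
    rewrite (bigD1 (Ordinal im))//= big1 ?addr0 ?indicE ?mem_set// => j ji.
    rewrite indicE memNset// => Fj.
    move/trivIsetP : tF => /(_ i j I I).
    rewrite eq_sym (_ : (nat_of_ord j != i) = (j != Ordinal im))// => /(_ ji) h.
    by have : (F i `&` F j) x by []; rewrite h.
  rewrite notin_setE => nF.
  rewrite big1// => i _; rewrite indicE memNset// => Fi.
  by apply: nF; exists i => /=.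
apply: (C _ _ 1) => [m|m x|x].
- by apply: measurable_sum => i; exact: measurable_indic.
- by rewrite sumE indicE; case: (_ \in _); rewrite ?normr1 ?normr0.
- apply: cvg_near_cst; have [[i _ Fi]|nF] := pselect ((\bigcup_i F i) x).
    near=> m; rewrite sumE !indicE !mem_set//; first by exists i.
    by exists i => //=; near: m; exact: nbhs_infty_gt.
  near=> m; rewrite sumE !indicE !memNset// => -[i _ Fi].
  by apply: nF; exists i.
Unshelve. all: by end_near. Qed.

HB.instance Definition _ := isCharge.Build _ _ _ functional_charge
  functional_charge0 functional_charge_fin functional_charge_sigma_additive.

Lemma ex_functional_charge : exists nu : {charge set T -> \bar R},
  (forall A, nu A = (J \1_A)%:E) /\
  forall f, bounded_measurable f -> charge_integral nu f = J f.
Proof. by exists functional_charge; split=> //; exact: charge_integral_eq. Qed.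

End ChargeOfFunctional.

(** * Independent uniform coordinates *)

Section UniformCube.
Context {R : realType}.
Local Open Scope ereal_scope.

(** The identity on [0, 1], where the uniform law lives; clamping gives the bounds at every sample
    point instead of almost every one. *)
Definition clamp01 (x : R) : R := Num.min 1%R (Num.max 0%R x).

Lemma measurable_clamp01 : measurable_fun setT clamp01.
Proof. by apply: measurable_minr => //; exact: measurable_maxr. Qed.

Lemma measurable_clamp01_ball (c r : R) :
  measurable [set x | (`|clamp01 x - c| <= r)%R].
Proof.
rewrite -[X in measurable X]setTI; apply: measurable_fun_ler => //.
apply: measurableT_comp => //; apply: measurable_funB => //.
exact: measurable_clamp01.
Qed.

Lemma uniform_prob_itv (c r : R) : (0 <= r)%R ->
  uniform_prob (@ltr01 R) [set x | (`|clamp01 x - c| <= r)%R] <= (2 * r)%:E.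
Proof.
move=> r0.
have mA := measurable_clamp01_ball c r.
rewrite /uniform_prob integral_uniform_pdf.
set B := _ `&` _.
have mB : measurable B by exact: measurableI.
apply: (@le_trans _ _ (\int[lebesgue_measure]_(x in B) (cst 1%:E x))).
  apply: ge0_le_integral => //.
  - by move=> x _; rewrite lee_fin uniform_pdf_ge0.
  - by apply/measurable_EFinP/measurable_funTS; exact: measurable_uniform_pdf.
  - move=> x _; rewrite lee_fin /uniform_pdf; case: ifP => // _.
    by rewrite subr0 invr1.
rewrite integral_cst// mul1e.
apply: (@le_trans _ _ (lebesgue_measure `[(c - r)%R, (c + r)%R])).
  apply: le_measure; rewrite ?inE//.
  move=> x [/= h]; rewrite !in_itv/= => /andP[x0 x1].
  move: h; rewrite /clamp01 (max_idPr x0) (min_idPr x1) ler_norml.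
  by move=> /andP[? ?]; apply/andP; split; lra.
rewrite lebesgue_measure_itv/= lte_fin; case: ifP => _.
  by rewrite -EFinB lee_fin; lra.
by rewrite lee_fin mulr_ge0.
Qed.

(** Built as an iterated product. The estimate for cubes is the link to n-dimensional Hausdorff
    measure. *)
Lemma ex_uniform_cube (n : nat) :
  exists d (W : measurableType d) (P : probability W R) (X : 'I_n -> W -> R),
  [/\ forall i, measurable_fun setT (X i),
      forall i w, (0 <= X i w <= 1)%R &
      forall (c : 'I_n -> R) (r : R), (0 <= r)%R ->
        P [set w | forall i, (`|X i w - c i| <= r)%R] <= ((2 * r) ^+ n)%:E].
Proof.
elim: n => [|n [d [W [P [X [mX X01 PX]]]]]].
  exists _, _, (uniform_prob (@ltr01 R)), (fun=> cst 0%R); split => //.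
  - by move=> i w; rewrite lexx ler01.
  - by move=> c r r0; rewrite expr0 probability_le1//;
      rewrite (_ : [set _ | _] = setT)//; apply/seteqP; split => // w _ [].
exists _, _, (uniform_prob (@ltr01 R) \x P).
exists (fun i w => if unlift ord0 i is Some j then X j w.2 else clamp01 w.1).
split.
- move=> i; case: unliftP => [j _|_].
    exact: measurableT_comp.
  by apply: measurableT_comp => //; exact: measurable_clamp01.
- move=> i w; case: unliftP => [j _|_]; first exact: X01.
  by rewrite /clamp01 le_min ler01 le_max lexx/= ge_min lexx.
- move=> c r r0.
  have mA := measurable_clamp01_ball (c ord0) r.
  pose c' i := c (lift ord0 i).
  have mB : measurable [set w | forall i, (`|X i w - c' i| <= r)%R].
    apply: (@measurable_forall_ord _ _ _
      (fun i => [set w | (`|X i w - c' i| <= r)%R])) => i.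
    rewrite -[X in measurable X]setTI; apply: measurable_fun_ler => //.
    by apply: measurableT_comp => //; apply: measurable_funB.
  rewrite (_ : [set w | _] = [set x | (`|clamp01 x - c ord0| <= r)%R] `*`
      [set w | forall i, (`|X i w - c' i| <= r)%R]); last first.
    apply/seteqP; split => w /=.
      by move=> h; split => [|i]; [have := h ord0; rewrite unlift_none
        | have := h (lift ord0 i); rewrite liftK].
    by move=> [h0 h] i; case: unliftP => [j ->|->//]; exact: h.
  apply: (@le_trans _ _ (uniform_prob (@ltr01 R)
      [set x | (`|clamp01 x - c ord0| <= r)%R] *
      P [set w | forall i, (`|X i w - c' i| <= r)%R])).
    by rewrite le_eqVlt; apply/orP; left; apply/eqP; exact: product_measure1E.
  rewrite exprS EFinM; apply: lee_pmul => //.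
  - exact: uniform_prob_itv.
  - exact: PX.
Qed.

End UniformCube.

(** * Measurable choice of a root *)

Section LastRoot.
Context {R : realType} d (W : measurableType d).

(** The root is the supremum of the set where [H w] is negative: by continuity [H w] is neither
    negative nor positive there. *)
Lemma ex_measurable_last_root (H : W -> R -> R) :
  (forall w, continuous (H w)) ->
  (forall t, measurable_fun setT (H ^~ t)) ->
  (forall w, H w 0 < 0) ->
  (forall w, exists M, forall t, H w t < 0 -> t <= M) ->
  exists t : W -> R, measurable_fun setT t /\
    forall w, 0 < t w /\ H w (t w) = 0.
Proof.
move=> cH mH H0 bH.
pose S w := [set t | H w t < 0].
have supS w : has_sup (S w).
  split; first by exists 0; exact: H0.
  by have [M HM] := bH w; exists M => t; exact: HM.
have near_neg w t : H w t < 0 -> exists2 e, 0 < e &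
    forall s, `|t - s| < e -> H w s < 0.
  move=> Ht.
  have : \forall s \near t, H w s < 0 by exact: cvgr_lt (cH w t) _ Ht.
  by case/nbhs_ballP => e /= e0 he; exists e => // s; exact: he.
have near_pos w t : 0 < H w t -> exists2 e, 0 < e &
    forall s, `|t - s| < e -> 0 < H w s.
  move=> Ht.
  have : \forall s \near t, 0 < H w s by exact: cvgr_gt (cH w t) _ Ht.
  by case/nbhs_ballP => e /= e0 he; exists e => // s; exact: he.
have sup_gt w t : H w t < 0 -> t < sup (S w).
  move=> /near_neg[e e0 he]; apply: (@lt_le_trans _ _ (t + e / 2)).
    by rewrite ltrDl divr_gt0.
  apply: ub_le_sup; first exact: (supS w).2.
  apply: he; rewrite opprD addrA subrr sub0r normrN gtr0_norm ?divr_gt0//.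
  by rewrite ltr_pdivrMr// ltr_pMr// ltr1n.
exists (fun w => sup (S w)); split.
  apply: (measurability _ (RGenOInfty.measurableE R)) => _ [_ [r ->] <-].
  rewrite setTI.
  (* Negativity is an open condition, so it can be tested at rationals, and each point of negativity
     lies strictly below the supremum. *)
  rewrite (_ : _ @^-1` _ = \bigcup_(q : rat)
      (if r < ratr q then [set w | H w (ratr q) < 0] else set0)); last first.
    apply/seteqP; split => w /=.
      rewrite in_itv/= andbT => rs.
      have e0 : 0 < sup (S w) - r by rewrite subr_gt0.
      have [t St] := sup_adherent e0 (supS w).
      rewrite opprB addrC subrK => rt.
      have [e e_gt0 he] := near_neg _ _ St.
      have : Num.max r (t - e) < t by rewrite gt_max rt gtrBl.
      move=> /rat_in_itvoo[q]; rewrite in_itv/= => /andP[].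
      rewrite gt_max => /andP[rq tq] qt.
      exists q => //; rewrite rq; apply: he.
      by rewrite gtr0_norm ?subr_gt0// ltrBlDr -ltrBlDl.
    move=> [q _]; case: ifP => // rq /sup_gt h.
    by rewrite in_itv/= andbT (lt_trans rq).
  apply: bigcupT_measurable_rat => q; case: ifP => // _.
  rewrite -[X in measurable X]setTI; apply: measurable_fun_ltr => //.
move=> w; split; first exact: sup_gt.
have [neg|pos|//] := ltgtP (H w (sup (S w))) 0.
  by have := sup_gt _ _ neg; rewrite ltxx.
have [e e0 he] := near_pos _ _ pos.
have [t St et] := sup_adherent e0 (supS w).
have ts : t <= sup (S w) by apply: ub_le_sup => //; exact: (supS w).2.
have : 0 < H w t by apply: he; rewrite ger0_norm ?subr_ge0// ltrBlDr -ltrBlDl.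
by rewrite ltNge ltW.
Qed.

End LastRoot.

(** * Null sets of Hausdorff measure *)

Section HausdorffNull.
Context {R : realType} {N : nat}.
Implicit Types A U : set 'rV[R]_N.
Local Open Scope ereal_scope.

Lemma coord_le_enorm (x : 'rV[R]_N) i : (`|x ord0 i| <= enorm x)%R.
Proof.
rewrite /enorm /dotv -sqrtr_sqr ler_wsqrtr// (bigD1 i)//= expr2 lerDl.
by apply: sumr_ge0 => j _; rewrite -expr2 sqr_ge0.
Qed.

Lemma ediam_ge0 A : 0 <= ediam A.
Proof. by rewrite /ediam le_max lexx. Qed.

Lemma enorm_le_ediam A x y : A x -> A y -> (enorm (x - y)%R)%:E <= ediam A.
Proof.
move=> Ax Ay; rewrite /ediam le_max; apply/orP; right.
by apply: ereal_sup_ubound; exists (x, y).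
Qed.

(* The pieces of a cover of A pull back into cubes whose side is comparable to
   their diameter. *)
Lemma hausdorff_null_preimage (n : nat) d (W : measurableType d)
    (P : probability W R) (X : 'I_n -> W -> R) (psi : W -> 'rV[R]_N) (C : R) A :
  (0 < C)%R -> (forall i, measurable_fun setT (X i)) ->
  (forall (c : 'I_n -> R) (r : R), (0 <= r)%R ->
    P [set w | forall i, (`|X i w - c i| <= r)%R] <= ((2 * r) ^+ n)%:E) ->
  (forall i w w', (`|X i w - X i w'| <= C * enorm (psi w - psi w'))%R) ->
  measurable (psi @^-1` A) -> hausdorff n A = 0 -> P (psi @^-1` A) = 0.
Proof.
move=> C0 mX PX LX mA A0.
apply/eqP; rewrite eq_le measure_ge0 andbT.
apply/lee_addgt0Pr => e e0; rewrite add0e.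
pose k := ((2 * C) ^+ n)%R.
have k0 : (0 < k)%R by rewrite exprn_gt0// mulr_gt0.
(* The bound 1 on the diameters makes them finite, so that taking [fine] of them is harmless. *)
have : hausdorff_pre n 1%R A < (e / k)%:E.
  apply: (@le_lt_trans _ _ (hausdorff n A)).
    by apply: ereal_sup_ubound; exists 1%R => /=.
  by rewrite A0 lte_fin divr_gt0.
move=> /ereal_inf_lt[_ [U [AU U1] <-] Ue].
have dfin j : ediam (U j) \is a fin_num.
  by rewrite ge0_fin_numE ?ediam_ge0// (le_lt_trans (U1 j))// ltry.
pose r j : R := fine (ediam (U j)).
have r0 j : (0 <= r j)%R by rewrite fine_ge0// ediam_ge0.
pose hit j := exists w, U j (psi w).
(* A cube centred at the coordinates of some sample point that [psi] sends into [U j], and empty if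
   there is none. *)
pose B (j : nat) : set W := if pselect (hit j) is left h then
  [set w | forall i, (`|X i w - X i (projT1 (cid h))| <= C * r j)%R] else set0.
have mB j : measurable (B j).
  rewrite /B; case: pselect => // h.
  apply: (@measurable_forall_ord _ _ _
    (fun i => [set w | (`|X i w - X i (projT1 (cid h))| <= C * r j)%R])) => i.
  rewrite -[X in measurable X]setTI; apply: measurable_fun_ler => //.
  by apply: measurableT_comp => //; apply: measurable_funB.
have PB j : P (B j) <= k%:E * ediam (U j) ^+ n.
  rewrite -(fineK (dfin j)) -/(r j) -EFin_expe -EFinM /k -exprMn -mulrA.
  rewrite /B; case: pselect => [h|_]; last first.
    by rewrite measure0 lee_fin exprn_ge0// !mulr_ge0// ltW.
  by apply: (PX (fun i => X i (projT1 (cid h)))); rewrite mulr_ge0// ltW.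
have AB : psi @^-1` A `<=` \bigcup_j B j.
  move=> w /AU[j _ Uj]; exists j => //; rewrite /B.
  case: pselect => [h|[]]; last by exists w.
  move=> i /=; case: cid => w' Uw' /=.
  rewrite (le_trans (LX i w w'))// ler_pM2l//.
  by rewrite -lee_fin /r fineK//; exact: enorm_le_ediam.
have sub : P (psi @^-1` A) <= \sum_(0 <= j <oo) P (B j).
  exact: measure_sigma_subadditive.
apply: (le_trans sub).
apply: (@le_trans _ _ (\sum_(0 <= j <oo) (k%:E * ediam (U j) ^+ n))).
  by apply: lee_nneseries => // j _.
rewrite nneseriesZl; last by move=> j _; rewrite expe_ge0// ediam_ge0.
apply: (@le_trans _ _ (k%:E * (e / k)%:E)).
  by rewrite lee_pmul2l// ltW.
by rewrite -EFinM mulrCA divff ?mulr1// gt_eqF.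
Qed.

End HausdorffNull.

(** * A measure that a transversal hyperplane does not detect *)

Section Necessity.
Context {R : realType} {n : nat}.
Implicit Types (a p v : 'rV[R]_n.+1).

Local Notation hd i := (widen_ord (leqnSn n) i).

(** Negative exactly where the last coordinate exceeds the height, strictly inside the epigraph. *)
Definition defect v : R :=
  \sum_(i < n) expR (v ord0 (hd i) ^+ 2) - v ord0 ord_max.

Lemma exp_square_surfaceE v : exp_square_surface v <-> defect v = 0.
Proof.
rewrite /exp_square_surface /defect /=.
by split=> [->|/subr0_eq ->//]; rewrite subrr.
Qed.

(** The [k]-th coordinate along the ray is [t * a ord0 (hd k)], so its exponential term outgrows the
    affine last coordinate and the ray must leave the epigraph. *)
Lemma ex_ray_crossing d (W : measurableType d) (p : W -> 'rV[R]_n.+1) a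
    (k : 'I_n) :
  a ord0 (hd k) != 0 ->
  (forall i, measurable_fun setT (fun w => p w ord0 i)) ->
  (forall w, p w ord0 (hd k) = 0) -> (forall w, defect (p w) < 0) ->
  exists t : W -> R, measurable_fun setT t /\
    forall w, 0 < t w /\ exp_square_surface (p w + t w *: a).
Proof.
move=> ak0 mp pk p0.
have E w t : defect (p w + t *: a) =
    \sum_(i < n) expR ((p w ord0 (hd i) + t * a ord0 (hd i)) ^+ 2) -
    (p w ord0 ord_max + t * a ord0 ord_max).
  by rewrite /defect !mxE; congr (_ - _); apply: eq_bigr => i _; rewrite !mxE.
pose H w (t : R) :=
  \sum_(i < n) expR ((p w ord0 (hd i) + t * a ord0 (hd i)) ^+ 2) -
  (p w ord0 ord_max + t * a ord0 ord_max).
have [w t||w|w|t [mt tP]] := @ex_measurable_last_root _ _ W H.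
- have cl (x y : R) : {for t, continuous (fun s : R => x + s * y)}.
    apply: cvgD; first exact: cvg_cst.
    by apply: cvgM; [exact: cvg_id|exact: cvg_cst].
  apply: cvgB; last exact: cl.
  apply: cvg_big => [|i _]; first exact: add_continuous.
  apply: (@continuous_comp _ _ _
    (fun s : R => (p w ord0 (hd i) + s * a ord0 (hd i)) ^+ 2) (@expR R)).
    apply: (@continuous_comp _ _ _
      (fun s : R => p w ord0 (hd i) + s * a ord0 (hd i)) (fun x => x ^+ 2)).
      exact: cl.
    exact: exprn_continuous.
  exact: continuous_expR.
- move=> t; apply: measurable_funB.
    apply: measurable_sum => i; apply: measurableT_comp => //.
    by apply: measurable_funX; apply: measurable_funD.
  by apply: measurable_funD.
- by have := p0 w; rewrite -[p w]addr0 -(scale0r a) E.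
- set A := a ord0 (hd k) ^+ 2; have A0 : 0 < A by rewrite exprn_even_gt0.
  pose l := p w ord0 ord_max; pose al := a ord0 ord_max.
  (* Beyond this bound [t > 1] and [t * A > |l| + |al|], so [t ^+ 2 * A] exceeds [l + t * al]. *)
  exists ((`|l| + `|al|) / A + 1) => t.
  rewrite /H (bigD1 k)//= pk add0r exprMn -/A.
  have : 1 + t ^+ 2 * A <= expR (t ^+ 2 * A) by exact: expR_ge1Dx.
  have : 0 <= \sum_(i < n | i != k)
      expR ((p w ord0 (hd i) + t * a ord0 (hd i)) ^+ 2).
    by apply: sumr_ge0 => i _; exact: expR_ge0.
  set S := \sum_(_ < _ | _) _; rewrite -/l -/al => S0 e1 e2.
  rewrite leNgt; apply/negP => tM.
  have c0 : 0 <= (`|l| + `|al|) / A by rewrite divr_ge0 ?addr_ge0// ltW.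
  have t1 : 1 < t by rewrite (le_lt_trans _ tM)// lerDr.
  have tA : `|l| + `|al| < t * A.
    by rewrite -ltr_pdivrMr// (le_lt_trans _ tM)// lerDl.
  have : t * (`|l| + `|al|) < t * (t * A).
    by rewrite ltr_pM2l// (lt_trans ltr01).
  have : `|l| <= t * `|l| by rewrite ler_peMl// ltW.
  have : t * al <= t * `|al| by rewrite ler_pM2l ?ler_norm// (lt_trans ltr01).
  have := ler_norm l.
  rewrite mulrA -expr2 mulrDr; lra.
- exists t; split => // w; have [t0 h] := tP w.
  by split => //; apply/exp_square_surfaceE; rewrite E.
Qed.

Lemma Rintegral_null_preimage d (W : measurableType d) (P : probability W R)
    (psi : W -> 'rV[R]_n.+1) (w : W -> R) (A : set 'rV[R]_n.+1) :
  measurable (psi @^-1` A) -> bounded_measurable w -> P (psi @^-1` A) = 0%E ->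
  Rintegral P setT (fun x => w x * \1_A (psi x)) = 0.
Proof.
move=> mA [mw _] PA.
rewrite (_ : (fun x => _) = w \_ (psi @^-1` A)); last first.
  apply/funext => x; rewrite patchE indicE.
  have -> : (x \in psi @^-1` A) = (psi x \in A) by apply/idP/idP; rewrite !inE.
  by case: (_ \in _); rewrite ?mulr1 ?mulr0.
rewrite -Rintegral_mkcond /Rintegral null_set_integral//.
by apply/measurable_EFinP; exact: measurable_funTS.
Qed.

(* The points p w + t1 w *: a and p w + t2 w *: a are the ends of a chord of the
   surface with direction a. The weights theta make the two ends cancel on L,
   and C is a Lipschitz constant for the inverse of w |-> p w + t w *: a. *)
Lemma transversal_not_uniqueness a (b : R) (k : 'I_n) : a ord0 (hd k) != 0 ->
  ~ heisenberg_uniqueness_pair (@exp_square_surface R n) [set x | dotv a x = b].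
Proof.
move=> ak0 HUP.
have [d [W [P [X [mX X01 PX]]]]] := @ex_uniform_cube R n.
(* Head coordinates in [0, 1] give a height of at most [n%:R * expR 1], so [K] puts [p w] strictly
   inside the epigraph. *)
pose K : R := n%:R * expR 1 + 1.
(* The [k]-th coordinate is frozen at 0, transversally to [a], and its random variable [X k] moves
   the last coordinate instead. *)
pose p w : 'rV[R]_n.+1 := \row_i (if unlift ord_max i is Some j then
  if j == k then 0 else X j w else X k w + K).
have pE w j : p w ord0 (hd j) = if j == k then 0 else X j w.
  by rewrite widen_ord_lift_max mxE liftK.
have pl w : p w ord0 ord_max = X k w + K by rewrite mxE unlift_none.
have pk w : p w ord0 (hd k) = 0 by rewrite pE eqxx.
have mp i : measurable_fun setT (fun w => p w ord0 i).
  have [j ->|->] := unliftP ord_max i.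
    have -> : (fun w => p w ord0 (lift ord_max j)) =
        fun w => if j == k then 0 else X j w.
      by apply/funext => w; rewrite -widen_ord_lift_max pE.
    by case: (j == k).
  have -> : (fun w => p w ord0 ord_max) = fun w => X k w + K.
    by apply/funext => w; exact: pl.
  exact: measurable_funD.
have p0 w : defect (p w) < 0.
  rewrite /defect pl subr_lt0 (@le_lt_trans _ _ (n%:R * expR 1))//; last first.
    by rewrite /K; case/andP: (X01 k w) => h _; lra.
  have -> : n%:R * expR 1 = \sum_(j < n) expR 1 :> R.
    by rewrite sumr_const card_ord mulr_natl.
  apply: ler_sum => j _; rewrite ler_expR pE; case: ifP => _.
    by rewrite expr0n ler01.
  by have /andP[? ?] := X01 j w; rewrite expr_le1.
have [t1 [mt1 t1P]] := ex_ray_crossing ak0 mp pk p0.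
(* The crossing on the other side is found along the ray in direction [- a]. *)
have Nak0 : (- a) ord0 (hd k) != 0 by rewrite mxE oppr_eq0.
have [t2' [mt2' t2'P]] := ex_ray_crossing Nak0 mp pk p0.
pose t2 w := - t2' w.
have mt2 : measurable_fun setT t2 by exact: measurableT_comp.
have t2P w : t2 w < 0 /\ exp_square_surface (p w + t2 w *: a).
  have [h1 h2] := t2'P w; split; first by rewrite oppr_lt0.
  by rewrite scaleNr -scalerN.
pose psi (t : W -> R) w : 'rV[R]_n.+1 := p w + t w *: a.
have psiE t w i : psi t w ord0 i = p w ord0 i + t w * a ord0 i by rewrite !mxE.
have mpsi t : measurable_fun setT t ->
    measurable_fun setT (psi t : W -> borel_rV R n.+1).
  move=> mt; apply: measurable_to_rV => i; under eq_fun do rewrite psiE.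
  by apply: measurable_funD => //; exact: measurable_funM.
pose C : R := 1 + \sum_i `|a ord0 i / a ord0 (hd k)|.
have C0 : 0 < C by rewrite ltr_pwDl// sumr_ge0.
have psiL t i w w' : `|X i w - X i w'| <= C * enorm (psi t w - psi t w').
  set u := psi t w - psi t w'.
  have uE j : u ord0 j = p w ord0 j - p w' ord0 j + (t w - t w') * a ord0 j.
    by rewrite /u !mxE; ring.
  have uk : t w - t w' = u ord0 (hd k) / a ord0 (hd k).
    by rewrite uE !pk subrr add0r mulfK.
  (* The coordinate that stores [X i]. Since [p] is 0 at [k], the [k]-th coordinate reveals [t], and
     subtracting the contribution of [t *: a] at [j] recovers [X i]. *)
  pose j := if i == k then ord_max else hd i.
  have -> : X i w - X i w' =
      u ord0 j - a ord0 j / a ord0 (hd k) * u ord0 (hd k).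
    rewrite uE uk /j; have [->|ik] := eqVneq i k; first by rewrite !pl; field.
    by rewrite !pE (negbTE ik); field.
  rewrite (le_trans (ler_normB _ _))// normrM mulrDl mul1r.
  rewrite lerD ?coord_le_enorm// ler_pM ?coord_le_enorm//.
  by rewrite (bigD1 j)//= lerDl sumr_ge0.
have mpre t A : measurable_fun setT t ->
    measurable (A : set (borel_rV R n.+1)) -> measurable (psi t @^-1` A).
  by move=> mt mA; rewrite -[X in measurable X]setTI; exact: mpsi.
have null t A : measurable_fun setT t ->
    (forall w, exp_square_surface (psi t w)) ->
    measurable (A : set (borel_rV R n.+1)) ->
    surface_measure (@exp_square_surface R n) A = 0%E ->
    P (psi t @^-1` A) = 0%E.
  move=> mt tG mA A0.
  (* The surface measure only sees the part of [A] on the surface, which has the same preimage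
     because [psi t] lands there. *)
  have AE : psi t @^-1` A = psi t @^-1` (A `&` @exp_square_surface R n).
    by apply/seteqP; split => w /= => [Aw|[]//]; split => //; exact: tG.
  rewrite AE; apply: (hausdorff_null_preimage C0 mX PX (psiL t)) => //.
  by rewrite -AE; exact: mpre.
pose theta w := pi * b * (t2 w - t1 w).
have mtheta : measurable_fun setT theta.
  by apply: measurable_funM => //; exact: measurable_funB.
have bN f : bounded_measurable f -> bounded_measurable (fun w : W => - f w : R).
  move=> bf; under eq_fun do rewrite -mulN1r.
  exact: (bounded_measurableM (bounded_measurable_cst _) bf).
have b1 : bounded_measurable (fun _ : W => 1 : R).
  exact: bounded_measurable_cst.
have bc : bounded_measurable (fun w => - cos (theta w)).
  exact/bN/bounded_measurable_cos.
have bs : bounded_measurable (fun w => - sin (theta w)).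
  exact/bN/bounded_measurable_sin.
have IP := Rintegral_bounded_functional P.
pose I := Rintegral P setT.
(* [J1] and [J2] are the real and imaginary part of the law of [psi t1] minus the law of [psi t2]
   weighted by e^{i theta}. *)
pose J1 (f : borel_rV R n.+1 -> R) :=
  I (fun w => 1 * f (psi t1 w)) + I (fun w => - cos (theta w) * f (psi t2 w)).
pose J2 (f : borel_rV R n.+1 -> R) :=
  I (fun w => - sin (theta w) * f (psi t2 w)).
have J1P : bounded_functional J1.
  apply: bounded_functionalD.
    exact: bounded_functional_pullback IP (mpsi _ mt1) b1.
  exact: bounded_functional_pullback IP (mpsi _ mt2) bc.
have J2P : bounded_functional J2.
  exact: bounded_functional_pullback IP (mpsi _ mt2) bs.
have [nu1 [nu1E nu1I]] := ex_functional_charge J1P.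
have [nu2 [nu2E nu2I]] := ex_functional_charge J2P.
pose mu := ComplexMeasure nu1 nu2.
have mu0 A : measurable (A : set (borel_rV R n.+1)) ->
    P (psi t1 @^-1` A) = 0%E -> P (psi t2 @^-1` A) = 0%E -> mu A = 0.
  move=> mA P1 P2; rewrite /mu /complex_measure_fun /= nu1E nu2E /= /J1 /J2 /I.
  by rewrite !Rintegral_null_preimage ?addr0//; exact: mpre.
have muS : supported_on mu (@exp_square_surface R n).
  move=> A mA A0; have e t : (forall w, exp_square_surface (psi t w)) ->
      psi t @^-1` A = set0.
    move=> tG; rewrite -subset0 => w Aw.
    by have : (A `&` @exp_square_surface R n) (psi t w) by []; rewrite A0.
  by apply: mu0 => //; rewrite e ?measure0// => w;
    [case: (t1P w)|case: (t2P w)].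
have muC : abs_continuous mu (surface_measure (@exp_square_surface R n)).
  by move=> A mA A0; apply: mu0 => //; apply: null => // w;
    [case: (t1P w)|case: (t2P w)].
have muF x : dotv a x = b -> fourier mu x = 0.
  move=> ax; rewrite fourierE /=.
  have bcx := bounded_cos_dotv x; have bsx := bounded_sin_dotv x.
  rewrite !nu1I// !nu2I// /J1 /J2.
  have psix t w : dotv x (psi t w) = dotv x (p w) + t w * b.
    rewrite -ax /dotv mulr_sumr -big_split/=; apply: eq_bigr => i _.
    by rewrite psiE; ring.
  (* For [x] on the hyperplane the phases at the two ends differ by [theta w], the same for all such
     [x]. *)
  have arg w : pi * dotv x (psi t1 w) = pi * dotv x (psi t2 w) - theta w.
    by rewrite !psix /theta; ring.
  have cosE : (fun w => 1 * cos (pi * dotv x (psi t1 w))) =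
      fun w => -1 * (- cos (theta w) * cos (pi * dotv x (psi t2 w)) +
                     - sin (theta w) * sin (pi * dotv x (psi t2 w))).
    by apply/funext => w; rewrite arg cosB; ring.
  have sinE : (fun w => 1 * sin (pi * dotv x (psi t1 w))) =
      fun w => - sin (theta w) * cos (pi * dotv x (psi t2 w)) +
               -1 * (- cos (theta w) * sin (pi * dotv x (psi t2 w))).
    by apply/funext => w; rewrite arg sinB; ring.
  have [ID IZ _] := IP.
  have bcx2 := bounded_measurable_comp (mpsi _ mt2) bcx.
  have bsx2 := bounded_measurable_comp (mpsi _ mt2) bsx.
  have bcc := bounded_measurableM bc bcx2.
  have bcs := bounded_measurableM bc bsx2.
  have bsc := bounded_measurableM bs bcx2.
  have bss := bounded_measurableM bs bsx2.
  rewrite cosE sinE /I (IZ _ _ (bounded_measurableD bcc bss)) (ID _ _ bcc bss).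
  have bNcs := bounded_measurableM (bounded_measurable_cst (-1)) bcs.
  rewrite (ID _ _ bsc bNcs) (IZ _ _ bcs).
  by apply/eqP; rewrite eq_complex /=; apply/andP; split; apply/eqP; ring.
(* The [k]-th coordinate of [psi t w] divided by that of [a] is [t w], so [A] contains all first
   ends and no second end, and the real part of [mu A] is 1. *)
pose A : set (borel_rV R n.+1) :=
  [set u | 0 < (u : 'rV[R]_n.+1) ord0 (hd k) / a ord0 (hd k)].
have mA : measurable A.
  rewrite -[X in measurable X]setTI; apply: measurable_fun_ltr => //.
  by apply: measurable_funM => //; exact: measurable_coord.
have psiA t w : A (psi t w) = (0 < t w) :> Prop.
  by rewrite /A /= psiE pk add0r mulfK.
have := congr1 (@complex.Re _) (HUP mu muS muC muF A mA).
rewrite /mu /complex_measure_fun /= nu1E /= /J1 /I.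
have -> : (fun w => 1 * \1_A (psi t1 w)) = fun=> 1 :> R.
  by apply/funext => w; rewrite indicE mem_set ?mulr1// psiA (t1P w).1.
have -> : (fun w => - cos (theta w) * \1_A (psi t2 w)) = fun=> 0 :> R.
  apply/funext => w; rewrite indicE memNset ?mulr0// psiA; apply/negP.
  by rewrite -leNgt ltW// (t2P w).1.
rewrite !Rintegral_cst// mul0r addr0 mul1r => PT.
have : fine (P setT) = 1 by rewrite probability_setT.
by rewrite [fine _]PT => /esym/eqP; rewrite oner_eq0.
Qed.

End Necessity.

Theorem theorem2p10 (R : realType) (n : nat) (L : set 'rV[R]_n.+1) :
  (1 <= n)%N -> affine_hyperplane L ->
  (heisenberg_uniqueness_pair (@exp_square_surface R n) L <->
   parallel_to_base L).
Proof.
move=> _ [a [b [a0 ->]]].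
split => [HUP|[c ->]]; last exact: parallel_uniqueness.
(* If all head coefficients of [a] vanish, the last one does not, and the hyperplane is a level set
   of the last coordinate. *)
have [k ak|vert] :=
    pickP (fun k : 'I_n => a ord0 (widen_ord (leqnSn n) k) != 0).
  by case: (transversal_not_uniqueness ak HUP).
have dotE x : dotv a x = a ord0 ord_max * x ord0 ord_max.
  rewrite /dotv big_ord_recr/= big1 ?add0r// => i _.
  by have /negbFE/eqP -> := vert i; rewrite mul0r.
have al0 : a ord0 ord_max != 0.
  apply: contra a0 => /eqP al; apply/eqP/rowP => i; rewrite mxE.
  have [j ->|->//] := unliftP ord_max i.
  by rewrite -widen_ord_lift_max; have /negbFE/eqP := vert j.
exists (b / a ord0 ord_max); apply/seteqP; split => x /=; rewrite dotE.
  by move=> <-; rewrite mulrC mulKf.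
by move=> ->; rewrite mulrC divfK.
Qed.
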